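(* Let $k$ be a field, $\mathfrak S$ a $k$-linear Grothendieck category, $H$ a cosemisimple Hopf algebra over $k$, $A$ a right $H$-comodule algebra, $B=A^{coH}$, and let $\mathcal N\in{}_B\mathfrak S$. Then $${}_A\mathcal E^H({}_BHOM(A,\mathcal N))\cong{}_BHOM(A,{}_B\mathcal E(\mathcal N)),\qquad\mathfrak C^H\big({}_A\mathcal E^H({}_BHOM(A,\mathcal N))\big)\cong{}_B\mathcal E(\mathcal N),$$ where ${}_A\mathcal E^H(-)$ denotes the injective envelope in ${}_A\mathfrak S^H$ and ${}_B\mathcal E(-)$ the injective envelope in ${}_B\mathfrak S$.
   Context: Write $\otimes=\otimes_k$. For $\mathcal M\in\mathfrak S$ and a $k$-vector space $V$, $\mathcal M\otimes V\in\mathfrak S$ is defined by letting $\mathcal M\otimes-:k\text{-Mod}\to\mathfrak S$ be the left adjoint of $\mathfrak S(\mathcal M,-)$; we identify $V\otimes\mathcal M$ with $\mathcal M\otimes V$, and $T$ denotes such swap isomorphisms. For a $k$-algebra $R$, ${}_R\mathfrak S$ is the (Grothendieck) category of left $R$-module objects in $\mathfrak S$ (objects with an associative unital action $R\otimes\mathcal M\to\mathcal M$). $H$ is cosemisimple if there is a left integral $\phi:H\to k$ (i.e. a $k$-linear map with $\sum h_1\phi(h_2)=\phi(h)1_H$ for all $h$) such that $\phi(1_H)=1$; then $\phi$ is also a right integral, $\sum\phi(h_1)h_2=\phi(h)1_H$. ${}_A\mathfrak S^H$ is the category of left-right relative $(A,H)$-Hopf module objects in $\mathfrak S$: triples $(\mathcal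 M,\mu_{\mathcal M}^A,\Delta_{\mathcal M}^H)$ where $\mu_{\mathcal M}^A:A\otimes\mathcal M\to\mathcal M$ is a left $A$-module structure on $\mathcal M\in\mathfrak S$, $\Delta_{\mathcal M}^H:\mathcal M\to\mathcal M\otimes H$ is a right $H$-comodule structure, and $\Delta^H_{\mathcal M}\circ\mu^A_{\mathcal M}=(\mu^A_{\mathcal M}\otimes\mu_H)\circ(A\otimes T_{H,\mathcal M}\otimes H)\circ(\Delta_A^H\otimes\Delta^H_{\mathcal M})$; morphisms are morphisms in $\mathfrak S$ compatible with the $A$-action and $H$-coaction. It is a Grothendieck category. $B=\{a\in A\mid\Delta_A^H(a)=a\otimes1_H\}$. For $\mathcal M\in{}_A\mathfrak S^H$, $\mathfrak C^H(\mathcal M)$ is the equalizer in $\mathfrak S$ of $\mathcal M\otimes u_H,\ \Delta^H_{\mathcal M}:\mathcal M\rightrightarrows\mathcal M\otimes H$ ($u_H$ the unit of $H$), with the left $B$-module structure restricted from the $A$-action on $\mathcal M$. The functor $\mathfrak C^H:{}_A\mathfrak S^H\to{}_B\mathfrak S$ has a right adjoint, denoted ${}_BHOM(A,-):{}_B\mathfrak S\to{}_A\mathfrak S^H$. *)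

(* Defs.v *)
From HB Require Import structures.
From mathcomp Require Import all_boot all_order all_algebra.
From mathcomp Require Import boolp.

Set Implicit Arguments.
Unset Strict Implicit.
Unset Printing Implicit Defensive.
Import GRing.Theory.

Local Open Scope ring_scope.

Record category := Category {
  obj :> Type;
  mor : obj -> obj -> Type;
  idm : forall X, mor X X;
  comp : forall X Y Z, mor Y Z -> mor X Y -> mor X Z;
  comp_idl : forall X Y (f : mor X Y), comp (idm Y) f = f;
  comp_idr : forall X Y (f : mor X Y), comp f (idm X) = f;
  comp_assoc : forall X Y Z W (h : mor Z W) (g : mor Y Z) (f : mor X Y),
    comp h (comp g f) = comp (comp h g) f
}.
Arguments mor {c} X Y.
Arguments idm {c} X.
Arguments comp {c X Y Z} g f.
Notation "g ∘ f" := (comp g f) (at level 40, left associativity).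

Record functor (C D : category) := Functor {
  fobj :> C -> D;
  fmap : forall X Y, mor X Y -> mor (fobj X) (fobj Y);
  fmap_id : forall X, fmap (idm X) = idm (fobj X);
  fmap_comp : forall X Y Z (g : mor Y Z) (f : mor X Y),
    fmap (g ∘ f) = fmap g ∘ fmap f
}.
Arguments fmap {C D} f {X Y} _ : rename.

(* F is left adjoint to G *)
Record adjunction (C D : category) (F : functor C D) (G : functor D C) := Adjunction {
  adj_unit : forall X : C, mor X (G (F X));
  adj_counit : forall Y : D, mor (F (G Y)) Y;
  adj_unit_nat : forall X X' (f : mor X X'),
    adj_unit X' ∘ f = fmap G (fmap F f) ∘ adj_unit X;
  adj_counit_nat : forall Y Y' (g : mor Y Y'),
    g ∘ adj_counit Y = adj_counit Y' ∘ fmap F (fmap G g);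
  adj_triangle_l : forall X, adj_counit (F X) ∘ fmap F (adj_unit X) = idm (F X);
  adj_triangle_r : forall Y, fmap G (adj_counit Y) ∘ adj_unit (G Y) = idm (G Y)
}.

Section CategoryNotions.
Variable C : category.

Definition isomorphic (X Y : C) : Prop :=
  exists (f : mor X Y) (g : mor Y X), g ∘ f = idm X /\ f ∘ g = idm Y.

Definition mono (X Y : C) (f : mor X Y) : Prop :=
  forall (Z : C) (g h : mor Z X), f ∘ g = f ∘ h -> g = h.

Definition epi (X Y : C) (f : mor X Y) : Prop :=
  forall (Z : C) (g h : mor Y Z), g ∘ f = h ∘ f -> g = h.

Definition injective_object (E : C) : Prop :=
  forall (X Y : C) (f : mor X Y) (g : mor X E), mono f -> exists h : mor Y E, h ∘ f = g.

(* In an abelian category this says that every nonzero subobject of E meets X. *)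
Definition essential_mono (X E : C) (i : mor X E) : Prop :=
  mono i /\ forall (Y : C) (g : mor E Y), mono (g ∘ i) -> mono g.

Definition is_injective_envelope (X E : C) (i : mor X E) : Prop :=
  injective_object E /\ essential_mono i.

Definition is_zero_object (Z : C) : Prop :=
  forall X : C, (exists! f : mor X Z, True) /\ (exists! f : mor Z X, True).

Definition is_product (X Y P : C) (p : mor P X) (q : mor P Y) : Prop :=
  forall (W : C) (f : mor W X) (g : mor W Y),
    exists! h : mor W P, p ∘ h = f /\ q ∘ h = g.

Definition is_coproduct (I : choiceType) (X : I -> C) (S : C)
    (s : forall i, mor (X i) S) : Prop :=
  forall (Y : C) (f : forall i, mor (X i) Y), exists! h : mor S Y, forall i, h ∘ s i = f i.

Definition is_equalizer (X Y : C) (f g : mor X Y) (E : C) (e : mor E X) : Prop :=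
  f ∘ e = g ∘ e /\
  forall (W : C) (t : mor W X), f ∘ t = g ∘ t -> exists! u : mor W E, e ∘ u = t.

Definition is_generator (G : C) : Prop :=
  forall (X Y : C) (f g : mor X Y), (forall h : mor G X, f ∘ h = g ∘ h) -> f = g.

End CategoryNotions.

Definition directed_set (d : Order.disp_t) (I : porderType d) : Prop :=
  inhabited I /\ forall i j : I, exists l : I, (i <= l)%O /\ (j <= l)%O.

Record direct_system (C : category) (d : Order.disp_t) (I : porderType d) := DirectSystem {
  ds_obj :> I -> C;
  ds_map : forall i j, (i <= j)%O -> mor (ds_obj i) (ds_obj j);
  ds_map_id : forall i (ii : (i <= i)%O), ds_map ii = idm (ds_obj i);
  ds_map_comp : forall i j l (ij : (i <= j)%O) (jl : (j <= l)%O) (il : (i <= l)%O),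
    ds_map jl ∘ ds_map ij = ds_map il
}.

Definition ds_natural (C : category) d (I : porderType d) (X Y : direct_system C I)
    (f : forall i, mor (X i) (Y i)) : Prop :=
  forall i j (ij : (i <= j)%O), ds_map Y ij ∘ f i = f j ∘ ds_map X ij.

Definition is_cocone (C : category) d (I : porderType d) (X : direct_system C I)
    (L : C) (l : forall i, mor (X i) L) : Prop :=
  forall i j (ij : (i <= j)%O), l j ∘ ds_map X ij = l i.

Definition is_direct_limit (C : category) d (I : porderType d) (X : direct_system C I)
    (L : C) (l : forall i, mor (X i) L) : Prop :=
  is_cocone l /\
  forall (Y : C) (f : forall i, mor (X i) Y), is_cocone f ->
    exists! u : mor L Y, forall i, u ∘ l i = f i.

Record lincat (k : fieldType) := Lincat {
  lobj : Type;
  lhom : lobj -> lobj -> lmodType k;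
  lidm : forall X, lhom X X;
  lcomp : forall X Y Z, lhom Y Z -> lhom X Y -> lhom X Z;
  lcomp_idl : forall X Y (f : lhom X Y), lcomp (lidm Y) f = f;
  lcomp_idr : forall X Y (f : lhom X Y), lcomp f (lidm X) = f;
  lcomp_assoc : forall X Y Z W (h : lhom Z W) (g : lhom Y Z) (f : lhom X Y),
    lcomp h (lcomp g f) = lcomp (lcomp h g) f;
  lcomp_linearl : forall X Y Z (f : lhom X Y),
    linear (fun g : lhom Y Z => lcomp g f);
  lcomp_linearr : forall X Y Z (g : lhom Y Z),
    linear (fun f : lhom X Y => lcomp g f)
}.

Definition underlying_category (k : fieldType) (C : lincat k) : category :=
  Category (@lcomp_idl k C) (@lcomp_idr k C) (@lcomp_assoc k C).
Coercion underlying_category : lincat >-> category.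

Section LinearNotions.
Variables (k : fieldType) (C : lincat k).

Definition zero_mor (X Y : C) : mor X Y := (0 : lhom X Y).

Definition is_kernel (X Y : C) (f : mor X Y) (K : C) (i : mor K X) : Prop :=
  f ∘ i = zero_mor _ _ /\
  forall (W : C) (t : mor W X), f ∘ t = zero_mor _ _ -> exists! u : mor W K, i ∘ u = t.

Definition is_cokernel (X Y : C) (f : mor X Y) (Q : C) (p : mor Y Q) : Prop :=
  p ∘ f = zero_mor _ _ /\
  forall (W : C) (t : mor Y W), t ∘ f = zero_mor _ _ -> exists! u : mor Q W, u ∘ p = t.

Definition short_exact (X Y Z : C) (f : mor X Y) (g : mor Y Z) : Prop :=
  is_kernel g f /\ is_cokernel f g.

Record is_abelian : Prop := IsAbelian {
  ab_zero : exists Z : C, is_zero_object Z;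
  ab_product : forall X Y : C, exists (P : C) (p : mor P X) (q : mor P Y), is_product p q;
  ab_kernel : forall (X Y : C) (f : mor X Y), exists (K : C) (i : mor K X), is_kernel f i;
  ab_cokernel : forall (X Y : C) (f : mor X Y), exists (Q : C) (p : mor Y Q), is_cokernel f p;
  ab_mono_normal : forall (X Y : C) (f : mor X Y), mono f ->
    exists (Z : C) (g : mor Y Z), is_kernel g f;
  ab_epi_normal : forall (X Y : C) (f : mor X Y), epi f ->
    exists (Z : C) (g : mor Z X), is_cokernel g f
}.

(* AB5 *)
Definition direct_limits_exact : Prop :=
  forall (d : Order.disp_t) (I : porderType d), directed_set I ->
  forall (X Y Z : direct_system C I)
    (f : forall i, mor (X i) (Y i)) (g : forall i, mor (Y i) (Z i)),
  ds_natural f -> ds_natural g -> (forall i, short_exact (f i) (g i)) ->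
  forall (LX LY LZ : C) (x : forall i, mor (X i) LX) (y : forall i, mor (Y i) LY)
    (z : forall i, mor (Z i) LZ),
  is_direct_limit x -> is_direct_limit y -> is_direct_limit z ->
  forall (u : mor LX LY) (v : mor LY LZ),
  (forall i, u ∘ x i = y i ∘ f i) ->
  (forall i, v ∘ y i = z i ∘ g i) ->
  short_exact u v.

Record is_grothendieck : Prop := IsGrothendieck {
  gr_abelian : is_abelian;
  gr_coproduct : forall (I : choiceType) (X : I -> C),
    exists (S : C) (s : forall i, mor (X i) S), is_coproduct s;
  gr_direct_limits : direct_limits_exact;
  gr_generator : exists G : C, is_generator G
}.

Lemma grothendieck_equalizer (hC : is_grothendieck) (X Y : C) (f g : mor X Y) :
  exists (E : C) (e : mor E X), is_equalizer f g e.
Proof.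
have eqE W (t : mor W X) : f ∘ t = g ∘ t <->
    ((f : lhom X Y) - (g : lhom X Y) : mor X Y) ∘ t = zero_mor W Y.
  have -> : ((f : lhom X Y) - (g : lhom X Y) : mor X Y) ∘ t =
      (f ∘ t : lhom W Y) - (g ∘ t : lhom W Y).
    by have := @lcomp_linearl _ C _ _ _ t (-1) g f; rewrite !scaleN1r ![- _ + _]addrC.
  by split=> [->|/eqP]; [rewrite subrr | rewrite subr_eq0 => /eqP].
have [K [i [/eqE fi univ]]] :=
  ab_kernel (gr_abelian hC) ((f : lhom X Y) - (g : lhom X Y) : mor X Y).
by exists K, i; split=> // W t /eqE; apply: univ.
Qed.

End LinearNotions.

Lemma linear_ext (k : fieldType) (V W : lmodType k) (f g : {linear V -> W}) :
  f =1 g -> f = g.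
Proof.
case: f g => f [[f1] [f2]] [g [[g1] [g2]]] /= /funext fg; subst g.
by rewrite (Prop_irrelevance f1 g1) (Prop_irrelevance f2 g2).
Qed.

Definition mklin (k : fieldType) (V W : lmodType k) (f : V -> W) (lf : linear f) :
  {linear V -> W} := HB.pack f (GRing.isLinear.Build k V W _ f lf).

Section LinearMaps.
Variables (k : fieldType) (V W : lmodType k).
Implicit Types f g h : {linear V -> W}.

HB.instance Definition _ := gen_eqMixin {linear V -> W}.
HB.instance Definition _ := gen_choiceMixin {linear V -> W}.

Fact lin_zero_subproof : linear (fun _ : V => 0 : W).
Proof. by move=> a u v; rewrite scaler0 addr0. Qed.
Fact lin_opp_subproof f : linear (fun v => - f v).
Proof. by move=> a u v; rewrite linearP opprD scalerN. Qed.
Fact lin_add_subproof f g : linear (fun v => f v + g v).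
Proof. by move=> a u v; rewrite !linearP scalerDr addrACA. Qed.
Fact lin_scale_subproof (c : k) f : linear (fun v => c *: f v).
Proof. by move=> a u v; rewrite linearP scalerDr !scalerA mulrC. Qed.

Definition lin_zero := mklin lin_zero_subproof.
Definition lin_opp f := mklin (lin_opp_subproof f).
Definition lin_add f g := mklin (lin_add_subproof f g).
Definition lin_scale c f := mklin (lin_scale_subproof c f).

Fact lin_addA : associative lin_add.
Proof. by move=> f g h; apply: linear_ext => v /=; rewrite addrA. Qed.
Fact lin_addC : commutative lin_add.
Proof. by move=> f g; apply: linear_ext => v /=; rewrite addrC. Qed.
Fact lin_add0 : left_id lin_zero lin_add.
Proof. by move=> f; apply: linear_ext => v /=; rewrite add0r. Qed.
Fact lin_addN : left_inverse lin_zero lin_opp lin_add.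
Proof. by move=> f; apply: linear_ext => v /=; rewrite addNr. Qed.

HB.instance Definition _ := GRing.isZmodule.Build {linear V -> W}
  lin_addA lin_addC lin_add0 lin_addN.

Fact lin_scaleA a b f : lin_scale a (lin_scale b f) = lin_scale (a * b) f.
Proof. by apply: linear_ext => v /=; rewrite scalerA. Qed.
Fact lin_scale1 : left_id 1 lin_scale.
Proof. by move=> f; apply: linear_ext => v /=; rewrite scale1r. Qed.
Fact lin_scaleDr : right_distributive lin_scale +%R.
Proof. by move=> a f g; apply: linear_ext => v /=; rewrite scalerDr. Qed.
Fact lin_scaleDl f : {morph lin_scale^~ f : a b / a + b}.
Proof. by move=> a b; apply: linear_ext => v /=; rewrite scalerDl. Qed.

HB.instance Definition _ := GRing.Zmodule_isLmodule.Build k {linear V -> W}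
  lin_scaleA lin_scale1 lin_scaleDr lin_scaleDl.

Lemma lin_addE f g v : (f + g) v = f v + g v. Proof. by []. Qed.
Lemma lin_scaleE (a : k) f v : (a *: f) v = a *: f v. Proof. by []. Qed.

End LinearMaps.

Section ModK.
Variable k : fieldType.

Definition lin_id (V : lmodType k) : {linear V -> V} := idfun.
Definition lin_comp (U V W : lmodType k) (g : {linear V -> W}) (f : {linear U -> V}) :
  {linear U -> W} := g \o f.

Definition modk : lincat k.
Proof.
refine (@Lincat k (lmodType k) (fun V W => {linear V -> W}) lin_id lin_comp _ _ _ _ _).
- by move=> V W f; apply: linear_ext.
- by move=> V W f; apply: linear_ext.
- by move=> U V W X h g f; apply: linear_ext.
- by move=> U V W f a g g'; apply: linear_ext.
- by move=> U V W g a f f'; apply: linear_ext => v /=; rewrite linearP.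
Defined.

End ModK.
Arguments modk k : clear implicits.

Section HomFunctor.
Variables (k : fieldType) (C : lincat k) (M : C).

Fact postcomp_linear X Y (f : lhom X Y) : linear (fun g : lhom M X => lcomp f g).
Proof. exact: lcomp_linearr. Qed.

Definition hom_functor : functor C (modk k).
Proof.
refine (@Functor C (modk k) (fun X => lhom M X : lmodType k)
  (fun X Y f => mklin (@postcomp_linear X Y f)) _ _).
- by move=> X; apply: linear_ext => f /=; rewrite lcomp_idl.
- by move=> X Y Z g f; apply: linear_ext => h /=; rewrite lcomp_assoc.
Defined.

End HomFunctor.

(* A choice, for every M, of a left adjoint M ⊗ - of Hom(M, -). For C = k-Mod this is
   the usual tensor product of vector spaces, by the tensor-hom adjunction. *)
Definition tensoring (k : fieldType) (C : lincat k) :=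
  forall M : C, {F : functor (modk k) C & adjunction F (hom_functor M)}.

Section Tensoring.
Variables (k : fieldType) (C : lincat k) (T : tensoring C).
Implicit Types (M N : C) (U V W : lmodType k).

Definition tensor (M : C) (V : lmodType k) : C := projT1 (T M) V.

Definition tin_lin (M : C) (V : lmodType k) : {linear V -> lhom M (tensor M V)} :=
  adj_unit (projT2 (T M)) V.

(* the morphism "m |-> m ⊗ v" *)
Definition tin (M : C) (V : lmodType k) (v : V) : mor M (tensor M V) := tin_lin M V v.

Lemma tin_linear M V : linear (tin M (V := V) : V -> lhom M (tensor M V)).
Proof. exact: linearP (tin_lin M V). Qed.

(* the morphism M ⊗ V -> N, "m ⊗ v |-> f v m", which corresponds to f by adjunction *)
Definition tdesc (M : C) (V : lmodType k) (N : C) (f : {linear V -> lhom M N}) :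
  mor (tensor M V) N :=
  adj_counit (projT2 (T M)) N ∘
  fmap (projT1 (T M)) (f : mor (V : modk k) (lhom M N : modk k)).

Definition tmapr (M : C) (V W : lmodType k) (g : {linear V -> W}) :
  mor (tensor M V) (tensor M W) :=
  fmap (projT1 (T M)) (g : mor (V : modk k) (W : modk k)).

Lemma tmaprE M V W (g : {linear V -> W}) v :
  tmapr M g ∘ tin M v = tin M (g v).
Proof.
by have /(congr1 (fun h : {linear V -> lhom M (tensor M W)} => h v)) :=
  adj_unit_nat (projT2 (T M)) (g : mor (V : modk k) (W : modk k)).
Qed.

Lemma tdescE M V N (f : {linear V -> lhom M N}) v : tdesc f ∘ tin M v = f v.
Proof.
rewrite /tdesc -comp_assoc; have -> := tmaprE M f v.
by have /(congr1 (fun h : {linear lhom M N -> lhom M N} => h (f v))) :=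
  adj_triangle_r (projT2 (T M)) N.
Qed.

Lemma tensor_ext M V N (g h : mor (tensor M V) N) :
  (forall v, g ∘ tin M v = h ∘ tin M v) -> g = h.
Proof.
move=> gh; rewrite -[g]comp_idr -[h]comp_idr.
rewrite -(adj_triangle_l (projT2 (T M)) (V : modk k)) !comp_assoc !adj_counit_nat.
rewrite -!comp_assoc -!fmap_comp; congr (_ ∘ fmap _ _).
by apply: linear_ext => v; apply: gh.
Qed.

Fact tmapl_subproof M N V (f : mor M N) :
  linear (fun v : V => tin N v ∘ f : lhom M (tensor N V)).
Proof. by move=> a u v; rewrite tin_linear; apply: lcomp_linearl. Qed.

Definition tmapl (M N : C) (f : mor M N) (V : lmodType k) :
  mor (tensor M V) (tensor N V) := tdesc (mklin (@tmapl_subproof M N V f)).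

Lemma tmaplE M N (f : mor M N) V v : tmapl f V ∘ tin M v = tin N v ∘ f.
Proof. exact: tdescE. Qed.

Definition tmap (M N : C) (f : mor M N) (V W : lmodType k) (g : {linear V -> W}) :
  mor (tensor M V) (tensor N W) := tmapr N g ∘ tmapl f V.

Lemma tmapE M N (f : mor M N) V W (g : {linear V -> W}) v :
  tmap f g ∘ tin M v = tin N (g v) ∘ f.
Proof. by rewrite -comp_assoc tmaplE comp_assoc tmaprE. Qed.

Fact tcontract_subproof M (V : lmodType k) (phi : {linear V -> k^o}) :
  linear (fun v => (phi v : k) *: (idm M : lhom M M)).
Proof. by move=> a u v; rewrite linearP scalerDl scalerA. Qed.

(* M ⊗ phi followed by the canonical isomorphism M ⊗ k -> M *)
Definition tcontract M (V : lmodType k) (phi : {linear V -> k^o}) : mor (tensor M V) M :=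
  tdesc (mklin (@tcontract_subproof M V phi)).

Fact tswap_subproof1 M V W (w : W) :
  linear (fun v : V => tin (tensor M W) v ∘ tin M w
            : lhom M (tensor (tensor M W) V)).
Proof. by move=> a u v; rewrite tin_linear; apply: lcomp_linearl. Qed.

Fact tswap_subproof2 M V W :
  linear (fun w : W => tdesc (mklin (@tswap_subproof1 M V W w))
            : lhom (tensor M V) (tensor (tensor M W) V)).
Proof.
move=> a u v; apply: tensor_ext => x; rewrite tdescE /= tin_linear.
by rewrite [RHS]lcomp_linearl ![lcomp (tdesc _) _]tdescE; apply: lcomp_linearr.
Qed.

(* (M ⊗ V) ⊗ W -> (M ⊗ W) ⊗ V, "(m ⊗ v) ⊗ w |-> (m ⊗ w) ⊗ v" *)
Definition tswap M V W : mor (tensor (tensor M V) W) (tensor (tensor M W) V) :=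
  tdesc (mklin (@tswap_subproof2 M V W)).

Lemma tswapE M V W v w :
  tswap M V W ∘ (tin _ w ∘ tin M v) = tin _ v ∘ tin M w.
Proof. by rewrite comp_assoc !tdescE. Qed.

End Tensoring.
Arguments tin : simpl never.
Arguments tdesc : simpl never.
Arguments tmapr : simpl never.
Arguments tmapl : simpl never.
Arguments tmap : simpl never.

Section Associativity.
Variables (k : fieldType) (TV : tensoring (modk k)).
Implicit Types U V W : lmodType k.

Definition vtensor (V W : lmodType k) : lmodType k := tensor TV (V : modk k) W.

Definition pure (V W : lmodType k) (v : V) (w : W) : vtensor V W :=
  tin TV (V : modk k) w v.

(* the linear map "v ⊗ w |-> f w v" *)
Definition vdesc (V W U : lmodType k) (f : {linear W -> {linear V -> U}}) :
  {linear vtensor V W -> U} :=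
  tdesc TV (M := V : modk k) (N := U : modk k) f.

Lemma vdescE V W U (f : {linear W -> {linear V -> U}}) v w :
  vdesc f (pure v w) = f w v.
Proof.
by have /(congr1 (fun h : {linear V -> U} => h v)) :=
  tdescE TV (M := V : modk k) (N := U : modk k) f w.
Qed.

Lemma vtensor_ext V W U (f g : {linear vtensor V W -> U}) :
  (forall v w, f (pure v w) = g (pure v w)) -> f = g.
Proof.
by move=> fg; apply: (@tensor_ext _ (modk k) TV V W U f g) => w; apply: linear_ext => v; apply: fg.
Qed.

Lemma pure_linearl V W (w : W) : linear (fun v : V => pure v w).
Proof. exact: linearP (tin TV (V : modk k) w : {linear V -> vtensor V W}). Qed.

Lemma pure_linearr V W (v : V) : linear (fun w : W => pure v w).
Proof.
move=> a u w.
exact: (congr1 (fun h : {linear V -> vtensor V W} => h v) (@tin_linear k (modk k) TV V W a u w)).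
Qed.

Variables (C : lincat k) (T : tensoring C).
Implicit Types M N : C.

Local Notation "M '⊗' V" := (tensor T M V) (at level 40, left associativity).
Local Notation "V '⊗k' W" := (vtensor V W) (at level 40, left associativity).

Fact rassoc_subproof1 M V W (w : W) :
  linear (fun v : V => tin T M (pure v w)).
Proof. by move=> a u v; rewrite pure_linearl tin_linear. Qed.

Fact rassoc_subproof2 M V W :
  linear (fun w : W => tdesc T (mklin (@rassoc_subproof1 M V W w))
            : lhom (M ⊗ V) (M ⊗ (V ⊗k W))).
Proof.
move=> a u v; apply: (tensor_ext (T := T)) => x; rewrite tdescE /= pure_linearr tin_linear.
by rewrite [RHS]lcomp_linearl ![lcomp (tdesc _ _) _]tdescE.
Qed.

(* "(m ⊗ v) ⊗ w |-> m ⊗ (v ⊗ w)" *)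
Definition rassoc M V W : mor (M ⊗ V ⊗ W) (M ⊗ (V ⊗k W)) :=
  tdesc T (mklin (@rassoc_subproof2 M V W)).

Lemma rassocE M V W v w :
  rassoc M V W ∘ (tin T _ w ∘ tin T M v) = tin T M (pure v w).
Proof. by rewrite comp_assoc !tdescE. Qed.

Fact rassoc_inv_subproof1 M V W (w : W) :
  linear (fun v : V => tin T (M ⊗ V) w ∘ tin T M v : lhom M (M ⊗ V ⊗ W)).
Proof. by move=> a u v; rewrite tin_linear; apply: lcomp_linearr. Qed.

Fact rassoc_inv_subproof2 M V W :
  linear (fun w : W => mklin (@rassoc_inv_subproof1 M V W w)).
Proof.
by move=> a u w; apply: linear_ext => v /=; rewrite tin_linear; apply: lcomp_linearl.
Qed.

(* "m ⊗ (v ⊗ w) |-> (m ⊗ v) ⊗ w" *)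
Definition rassoc_inv M V W : mor (M ⊗ (V ⊗k W)) (M ⊗ V ⊗ W) :=
  tdesc T (vdesc (mklin (@rassoc_inv_subproof2 M V W))).

Lemma rassoc_invE M V W v w :
  rassoc_inv M V W ∘ tin T M (pure v w) = tin T _ w ∘ tin T M v.
Proof. by rewrite tdescE vdescE. Qed.

Lemma rassocK M V W : rassoc_inv M V W ∘ rassoc M V W = idm _.
Proof.
apply: (tensor_ext (T := T)) => w; apply: (tensor_ext (T := T)) => v.
rewrite comp_idl -(comp_assoc _ (tin T _ _)) -(comp_assoc (rassoc_inv M V W)).
by rewrite rassocE rassoc_invE.
Qed.

Fact lassoc_subproof1 M V W (w : W) :
  linear (fun v : V => tin T M (pure w v)).
Proof. by move=> a u v; rewrite pure_linearr tin_linear. Qed.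

Fact lassoc_subproof2 M V W :
  linear (fun w : W => tdesc T (mklin (@lassoc_subproof1 M V W w))
            : lhom (M ⊗ V) (M ⊗ (W ⊗k V))).
Proof.
move=> a u v; apply: (tensor_ext (T := T)) => x; rewrite tdescE /= pure_linearl tin_linear.
by rewrite [RHS]lcomp_linearl ![lcomp (tdesc _ _) _]tdescE.
Qed.

(* With V ⊗ M identified with M ⊗ V, this is the associativity isomorphism
   W ⊗ (V ⊗ M) -> (W ⊗ V) ⊗ M, "w ⊗ (v ⊗ m) |-> (w ⊗ v) ⊗ m". *)
Definition lassoc M V W : mor (M ⊗ V ⊗ W) (M ⊗ (W ⊗k V)) :=
  tdesc T (mklin (@lassoc_subproof2 M V W)).

Lemma lassocE M V W v w :
  lassoc M V W ∘ (tin T _ w ∘ tin T M v) = tin T M (pure w v).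
Proof. by rewrite comp_assoc !tdescE. Qed.

(* With V ⊗ M identified with M ⊗ V, this is the middle swap
   (V ⊗ W) ⊗ (M ⊗ U) -> (V ⊗ M) ⊗ (W ⊗ U), "v ⊗ w ⊗ m ⊗ u |-> v ⊗ m ⊗ w ⊗ u". *)
Definition middle_swap M (U V W : lmodType k) :
  mor (M ⊗ U ⊗ (V ⊗k W)) (M ⊗ V ⊗ (W ⊗k U)) :=
  lassoc (M ⊗ V) U W ∘ tmapl T (tswap T M U V) W ∘ rassoc_inv (M ⊗ U) V W.

Lemma middle_swapE M U V W u v w :
  middle_swap M U V W ∘ (tin T _ (pure v w) ∘ tin T M u) =
  tin T _ (pure w u) ∘ tin T M v.
Proof.
rewrite /middle_swap -(comp_assoc _ (rassoc_inv _ _ _)).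
rewrite (comp_assoc (rassoc_inv _ _ _)) rassoc_invE.
rewrite -(comp_assoc (lassoc _ _ _)) -(comp_assoc (tin T _ w)) (comp_assoc (tmapl _ _ _)).
by rewrite tmaplE -(comp_assoc (tin T _ w)) tswapE (comp_assoc (tin T _ w)) comp_assoc lassocE.
Qed.

End Associativity.
Arguments pure : simpl never.
Arguments vdesc : simpl never.

(* MathComp's algType k, but with the zero algebra allowed. *)
Record algebra (k : fieldType) := Algebra {
  alg_car :> lmodType k;
  alg_one : alg_car;
  alg_mul : alg_car -> alg_car -> alg_car;
  alg_mulA : associative alg_mul;
  alg_mul1l : left_id alg_one alg_mul;
  alg_mul1r : right_id alg_one alg_mul;
  alg_linearl : forall y, linear (alg_mul^~ y);
  alg_linearr : forall x, linear (alg_mul x)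
}.
Arguments alg_one {k} a.
Notation "x ⋅ y" := (alg_mul x y) (at level 40, left associativity).

Section AlgType.
Variables (k : fieldType) (A : algType k).

Fact algType_linearl (y : A) : linear ( *%R^~ y).
Proof. by move=> a u v; rewrite mulrDl scalerAl. Qed.
Fact algType_linearr (x : A) : linear ( *%R x).
Proof. by move=> a u v; rewrite mulrDr scalerAr. Qed.

Definition algebra_of_algType : algebra k :=
  Algebra (@mulrA A) (@mul1r A) (@mulr1 A) algType_linearl algType_linearr.

End AlgType.

Section Multiplication.
Variables (k : fieldType) (TV : tensoring (modk k)).
Implicit Types R S : algebra k.

Definition rmul R (y : R) : {linear R -> R} := mklin (alg_linearl y).

Fact rmul_linear R : linear (@rmul R).
Proof.
by move=> a u v; apply: linear_ext => x /=; rewrite alg_linearr.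
Qed.

Definition mulmap R : {linear vtensor TV R R -> R} :=
  vdesc TV (mklin (@rmul_linear R)).

Lemma mulmapE R (x y : R) : mulmap R (pure TV x y) = x ⋅ y.
Proof. exact: vdescE. Qed.

Definition vtmap (V V' W W' : lmodType k) (f : {linear V -> V'}) (g : {linear W -> W'}) :
    {linear vtensor TV V W -> vtensor TV V' W'} :=
  tmap TV (M := V : modk k) (N := V' : modk k) f g.

Lemma vtmapE (V V' W W' : lmodType k) (f : {linear V -> V'}) (g : {linear W -> W'}) v w :
  vtmap f g (pure TV v w) = pure TV (f v) (g w).
Proof.
by have /(congr1 (fun h : {linear V -> vtensor TV V' W'} => h v)) :=
  tmapE TV (M := V : modk k) (N := V' : modk k) f g w.
Qed.

Arguments vtmap : simpl never.

Definition vassoc (U V W : lmodType k) :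
    {linear vtensor TV (vtensor TV U V) W -> vtensor TV U (vtensor TV V W)} :=
  rassoc TV TV (U : modk k) V W.

Fact tensor_mul_subproof1 R S (d : S) :
  linear (fun c : R => vtmap (rmul c) (rmul d)).
Proof.
move=> a c c'; apply: vtensor_ext => x y.
by rewrite lin_addE lin_scaleE !vtmapE /= alg_linearr pure_linearl.
Qed.

Fact tensor_mul_subproof2 R S :
  linear (fun d : S => mklin (@tensor_mul_subproof1 R S d)).
Proof.
move=> a d d'; apply: linear_ext => c; apply: vtensor_ext => x y.
change (vtmap (rmul c) (rmul (a *: d + d')) (pure TV x y) =
  a *: vtmap (rmul c) (rmul d) (pure TV x y) + vtmap (rmul c) (rmul d') (pure TV x y)).
by rewrite !vtmapE /= alg_linearr pure_linearr.
Qed.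

(* (a ⊗ b)(c ⊗ d) = ac ⊗ bd, extended bilinearly *)
Definition tensor_mul R S (s t : vtensor TV R S) : vtensor TV R S :=
  vdesc TV (mklin (@tensor_mul_subproof2 R S)) t s.

Lemma tensor_mulE R S (a c : R) (b d : S) :
  tensor_mul (pure TV a b) (pure TV c d) = pure TV (a ⋅ c) (b ⋅ d).
Proof. by rewrite /tensor_mul vdescE; apply: vtmapE. Qed.

Variables (V W U : lmodType k) (f : V -> W -> U).
Hypotheses (fl : forall w, linear (f^~ w)) (fr : forall v, linear (f v)).

Fact bilin_subproof : linear (fun w => mklin (fl w)).
Proof. by move=> a u w; apply: linear_ext => v /=; rewrite fr. Qed.

(* the linear map "v ⊗ w |-> f v w" *)
Definition bilin_desc : {linear vtensor TV V W -> U} := vdesc TV (mklin bilin_subproof).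

Lemma bilin_descE v w : bilin_desc (pure TV v w) = f v w.
Proof. exact: vdescE. Qed.

End Multiplication.

Section Hopf.
Variables (k : fieldType) (TV : tensoring (modk k)).

Section Convolution.
Variables (V : lmodType k) (R : algebra k) (f g : {linear V -> R}).

(* "v ⊗ w |-> f v ⋅ g w" *)
Definition mul_after : {linear vtensor TV V V -> R} := mulmap TV R \o vtmap TV f g.

End Convolution.

Section Slices.
Variables (V W : lmodType k).

Fact slicel_subproof1 (phi : {linear V -> k^o}) (w : W) :
  linear (fun v : V => (phi v : k) *: w).
Proof. by move=> a u v; rewrite linearP scalerDl scalerA. Qed.

Fact slicel_subproof2 (phi : {linear V -> k^o}) (v : V) :
  linear (fun w : W => (phi v : k) *: w).
Proof. by move=> a u w; rewrite scalerDr !scalerA mulrC. Qed.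

Fact slicer_subproof1 (phi : {linear W -> k^o}) (w : W) :
  linear (fun v : V => (phi w : k) *: v).
Proof. by move=> a u v; rewrite scalerDr !scalerA mulrC. Qed.

Fact slicer_subproof2 (phi : {linear W -> k^o}) (v : V) :
  linear (fun w : W => (phi w : k) *: v).
Proof. by move=> a u w; rewrite linearP scalerDl scalerA. Qed.

(* "v ⊗ w |-> phi v *: w" *)
Definition slicel (phi : {linear V -> k^o}) : {linear vtensor TV V W -> W} :=
  bilin_desc TV (slicel_subproof1 phi) (slicel_subproof2 phi).

(* "v ⊗ w |-> phi w *: v" *)
Definition slicer (phi : {linear W -> k^o}) : {linear vtensor TV V W -> V} :=
  bilin_desc TV (slicer_subproof1 phi) (slicer_subproof2 phi).

End Slices.
Arguments slicel {V W} phi.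
Arguments slicer {V W} phi.

Record hopf_algebra := HopfAlgebra {
  hopf_car :> algebra k;
  Delta : {linear hopf_car -> vtensor TV hopf_car hopf_car};
  counit : {linear hopf_car -> k^o};
  antipode : {linear hopf_car -> hopf_car};
  Delta_coassoc : forall h,
    vassoc TV _ _ _ (vtmap TV Delta idfun (Delta h)) = vtmap TV idfun Delta (Delta h);
  counit_l : forall h, slicel counit (Delta h) = h;
  counit_r : forall h, slicer counit (Delta h) = h;
  Delta_mul : forall g h, Delta (g ⋅ h) = tensor_mul (Delta g) (Delta h);
  Delta_one : Delta (alg_one _) = pure TV (alg_one _) (alg_one _);
  counit_mul : forall g h, counit (g ⋅ h) = (counit g : k) * counit h;
  counit_one : counit (alg_one _) = 1 :> k;
  antipode_l : forall h, mul_after antipode idfun (Delta h) = (counit h : k) *: alg_one _;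
  antipode_r : forall h, mul_after idfun antipode (Delta h) = (counit h : k) *: alg_one _
}.

Definition left_integral (H : hopf_algebra) (phi : {linear H -> k^o}) : Prop :=
  forall h, slicer phi (Delta H h) = (phi h : k) *: alg_one _.

Definition cosemisimple (H : hopf_algebra) : Prop :=
  exists phi : {linear H -> k^o}, left_integral phi /\ phi (alg_one H) = 1 :> k.

End Hopf.

Section Comodule.
Variables (k : fieldType) (TV : tensoring (modk k)) (H : hopf_algebra TV).
Variables (C : lincat k) (T : tensoring C).

Record is_coaction (M : C) (rho : mor M (tensor T M H)) : Prop := IsCoaction {
  coaction_counit : tcontract T M (counit H) ∘ rho = idm M;
  coaction_coassoc :
    rassoc TV T M H H ∘ tmapl T rho H ∘ rho = tmapr T M (Delta H) ∘ rho
}.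

End Comodule.

Record comodule_algebra (k : fieldType) (TV : tensoring (modk k)) (H : hopf_algebra TV) :=
  ComoduleAlgebra {
  ca_car :> algebra k;
  ca_coact : {linear ca_car -> vtensor TV ca_car H};
  ca_coactP : is_coaction (H := H) (T := TV) (M := ca_car : modk k) ca_coact;
  ca_mul : forall a b, ca_coact (a ⋅ b) = tensor_mul (ca_coact a) (ca_coact b);
  ca_one : ca_coact (alg_one _) = pure TV (alg_one _) (alg_one _)
}.

Section CoinvariantAlgebra.
Variables (k : fieldType) (TV : tensoring (modk k)) (H : hopf_algebra TV).
Variable A : comodule_algebra H.

Definition coinv_pred : {pred A} := fun a => `[< ca_coact A a = pure TV a (alg_one H) >].

Lemma coinvP a : reflect (ca_coact A a = pure TV a (alg_one H)) (a \in coinv_pred).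
Proof. exact: asboolP. Qed.

Fact coinv_submod : submod_closed coinv_pred.
Proof.
split=> [|a b c]; rewrite !unfold_in.
  apply/asboolP; rewrite linear0; symmetry.
  exact: (linear0 (mklin (pure_linearl TV (V := A) (alg_one H)))).
by move=> /asboolP bP /asboolP cP; apply/asboolP; rewrite linearP bP cP pure_linearl.
Qed.

Fact coinv_one_subproof : alg_one A \in coinv_pred.
Proof. by apply/coinvP; apply: ca_one. Qed.

Fact coinv_mul_subproof a b :
  a \in coinv_pred -> b \in coinv_pred -> a ⋅ b \in coinv_pred.
Proof.
by move=> /coinvP aP /coinvP bP; apply/coinvP; rewrite ca_mul aP bP tensor_mulE alg_mul1l.
Qed.

HB.instance Definition _ := GRing.isSubmodClosed.Build k A coinv_pred coinv_submod.

Record coinv := Coinv { coinv_val : A; coinv_valP : coinv_val \in coinv_pred }.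

HB.instance Definition _ := [isSub for coinv_val].
HB.instance Definition _ := [Choice of coinv by <:].
HB.instance Definition _ := [SubChoice_isSubZmodule of coinv by <:].
HB.instance Definition _ := [SubZmodule_isSubLmodule of coinv by <:].

Definition coinv_one : coinv := Coinv coinv_one_subproof.
Definition coinv_mul (x y : coinv) : coinv :=
  Coinv (coinv_mul_subproof (coinv_valP x) (coinv_valP y)).

Definition coinv_alg : algebra k.
Proof.
refine (@Algebra k coinv coinv_one coinv_mul _ _ _ _ _).
- by move=> x y z; apply: val_inj; apply: alg_mulA.
- by move=> x; apply: val_inj; apply: alg_mul1l.
- by move=> x; apply: val_inj; apply: alg_mul1r.
- by move=> y a u v; apply: val_inj; apply: alg_linearl.
- by move=> x a u v; apply: val_inj; apply: alg_linearr.
Defined.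

Definition coinv_incl : {linear coinv_alg -> A} := val.

End CoinvariantAlgebra.

(* The action R ⊗ M -> M is written as a morphism from M ⊗ R, with which R ⊗ M is
   identified; likewise throughout below. *)
Section Modules.
Variables (k : fieldType) (TV : tensoring (modk k)).
Variables (C : lincat k) (T : tensoring C) (R : algebra k).

Record is_action (M : C) (mu : mor (tensor T M R) M) : Prop := IsAction {
  action_one : mu ∘ tin T M (alg_one R) = idm M;
  action_mul : mu ∘ tmapl T mu R = mu ∘ tmapr T M (mulmap TV R) ∘ lassoc TV T M R R
}.

Record module := Module {
  mod_obj :> C;
  act : mor (tensor T mod_obj R) mod_obj;
  actP : is_action act
}.

Definition is_module_hom (M N : module) (f : mor M N) : Prop :=
  f ∘ act M = act N ∘ tmapl T f R.

Lemma tmapl_id (M : C) (V : lmodType k) : tmapl T (idm M) V = idm _.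
Proof. by apply: (tensor_ext (T := T)) => v; rewrite tmaplE comp_idl comp_idr. Qed.

Lemma tmapl_comp (M N P : C) (g : mor N P) (f : mor M N) (V : lmodType k) :
  tmapl T (g ∘ f) V = tmapl T g V ∘ tmapl T f V.
Proof.
apply: (tensor_ext (T := T)) => v.
by rewrite tmaplE -(comp_assoc (tmapl T g V)) tmaplE (comp_assoc (tmapl T g V)) tmaplE comp_assoc.
Qed.

Lemma module_hom_id (M : module) : is_module_hom (idm M).
Proof. by rewrite /is_module_hom tmapl_id comp_idl comp_idr. Qed.

Lemma module_hom_comp (M N P : module) (g : mor N P) (f : mor M N) :
  is_module_hom g -> is_module_hom f -> is_module_hom (g ∘ f).
Proof.
move=> gP fP; rewrite /is_module_hom tmapl_comp -comp_assoc fP.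
by rewrite comp_assoc gP comp_assoc.
Qed.

Definition module_category : category.
Proof.
refine (@Category module (fun M N => {f : mor M N | is_module_hom f})
  (fun M => exist _ _ (module_hom_id M))
  (fun M N P g f => exist _ _ (module_hom_comp (proj2_sig g) (proj2_sig f))) _ _ _).
- by move=> M N [f fP]; apply: eq_exist; apply: comp_idl.
- by move=> M N [f fP]; apply: eq_exist; apply: comp_idr.
- by move=> M N P Q h g f; apply: eq_exist; apply: comp_assoc.
Defined.

End Modules.

Section HopfModules.
Variables (k : fieldType) (TV : tensoring (modk k)).
Variables (C : lincat k) (T : tensoring C).
Variables (H : hopf_algebra TV) (A : comodule_algebra H).

Record hopf_module := HopfModule {
  hm_module :> module TV T A;
  coact : mor hm_module (tensor T hm_module H);
  coactP : is_coaction coact;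
  coact_act : coact ∘ act hm_module =
    tmap T (act hm_module) (mulmap TV H) ∘ middle_swap TV T hm_module H A H ∘
    tmap T coact (ca_coact A)
}.

Definition is_hopf_hom (M N : hopf_module) (f : mor (M : C) N) : Prop :=
  is_module_hom f /\ coact N ∘ f = tmapl T f H ∘ coact M.

Lemma hopf_hom_id (M : hopf_module) : is_hopf_hom (idm (M : C)).
Proof. by split; [apply: module_hom_id | rewrite tmapl_id comp_idl comp_idr]. Qed.

Lemma hopf_hom_comp (M N P : hopf_module) (g : mor (N : C) P) (f : mor (M : C) N) :
  is_hopf_hom g -> is_hopf_hom f -> is_hopf_hom (g ∘ f).
Proof.
move=> [g1 g2] [f1 f2]; split; first exact: module_hom_comp.
by rewrite tmapl_comp comp_assoc g2 -(comp_assoc _ (coact N)) f2 comp_assoc.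
Qed.

Definition hopf_module_category : category.
Proof.
refine (@Category hopf_module (fun M N => {f : mor (M : C) N | is_hopf_hom f})
  (fun M => exist _ _ (hopf_hom_id M))
  (fun M N P g f => exist _ _ (hopf_hom_comp (proj2_sig g) (proj2_sig f))) _ _ _).
- by move=> M N [f fP]; apply: eq_exist; apply: comp_idl.
- by move=> M N [f fP]; apply: eq_exist; apply: comp_idr.
- by move=> M N P Q h g f; apply: eq_exist; apply: comp_assoc.
Defined.

End HopfModules.

Section Coinvariants.
Variables (k : fieldType) (TV : tensoring (modk k)).
Variables (C : lincat k) (T : tensoring C).
Variables (H : hopf_algebra TV) (A : comodule_algebra H).
Hypothesis hC : is_grothendieck C.
Implicit Types M N P : hopf_module T A.

Local Notation B := (coinv_alg A).

(* the equalizer of M ⊗ u_H and the coaction; under M = M ⊗ k, M ⊗ u_H is m |-> m ⊗ 1 *)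
Definition coinv_equalizer M := cid (grothendieck_equalizer hC (tin T M (alg_one H)) (coact M)).

Definition coinv_obj M : C := proj1_sig (coinv_equalizer M).

Definition coinv_mor M : mor (coinv_obj M) M := proj1_sig (cid (proj2_sig (coinv_equalizer M))).

Lemma coinv_morP M : is_equalizer (tin T M (alg_one H)) (coact M) (coinv_mor M).
Proof. exact: proj2_sig (cid (proj2_sig (coinv_equalizer M))). Qed.

Definition coinv_lift M (W : C) (t : mor W M)
    (ht : tin T M (alg_one H) ∘ t = coact M ∘ t) : mor W (coinv_obj M) :=
  proj1_sig (cid (proj2 (coinv_morP M) W t ht)).

Lemma coinv_liftE M (W : C) (t : mor W M) ht :
  coinv_mor M ∘ @coinv_lift M W t ht = t.
Proof. exact: (proj1 (proj2_sig (cid (proj2 (coinv_morP M) W t ht)))). Qed.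

Lemma coinv_mor_mono M : mono (coinv_mor M).
Proof.
move=> W g h gh; have [me mu] := coinv_morP M.
have gP : tin T M (alg_one H) ∘ (coinv_mor M ∘ g) = coact M ∘ (coinv_mor M ∘ g).
  by rewrite (comp_assoc (tin T M _)) me (comp_assoc (coact M)).
by have [u [_ uniq]] := mu W _ gP; rewrite -(uniq g) // (uniq h).
Qed.

Lemma act_tin_mul (R : algebra k) (M : module TV T R) (r s : R) :
  act M ∘ tin T M r ∘ (act M ∘ tin T M s) = act M ∘ tin T M (r ⋅ s).
Proof.
have -> : act M ∘ tin T M r ∘ (act M ∘ tin T M s) =
    act M ∘ tmapl T (act M) R ∘ (tin T _ r ∘ tin T M s).
  rewrite (comp_assoc (act M ∘ tmapl T (act M) R)) -(comp_assoc (act M) (tmapl T _ _)).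
  by rewrite tmaplE (comp_assoc (act M)) -(comp_assoc (act M ∘ tin T M r)).
rewrite (action_mul (actP M)) -(comp_assoc _ (lassoc _ _ _ _ _)) lassocE.
by rewrite -(comp_assoc (act M)) tmaprE mulmapE.
Qed.

Lemma coact_act_coinv M (b : B) :
  coact M ∘ (act M ∘ tin T M (coinv_incl A b)) =
  tmapl T (act M ∘ tin T M (coinv_incl A b)) H ∘ coact M.
Proof.
set a := coinv_incl A b; have aP : ca_coact A a = pure TV a (alg_one H).
  by apply/coinvP; apply: coinv_valP.
rewrite (comp_assoc (coact M)) coact_act -(comp_assoc _ (tmap T (coact M) _)) tmapE aP.
rewrite comp_assoc; congr (_ ∘ _); apply: (tensor_ext (T := T)) => h.
rewrite -(comp_assoc _ (tin T _ (pure _ _ _))) -(comp_assoc (tmap _ _ _)) middle_swapE.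
rewrite (comp_assoc (tmap _ _ _)) tmapE mulmapE alg_mul1l tmaplE.
by rewrite -(comp_assoc (tin T M h)).
Qed.

Definition coinv_preact M : mor (tensor T (coinv_obj M) B) M :=
  act M ∘ tmap T (coinv_mor M) (coinv_incl A).

Lemma coinv_preactE M (b : B) :
  coinv_preact M ∘ tin T _ b = act M ∘ tin T M (coinv_incl A b) ∘ coinv_mor M.
Proof. by rewrite /coinv_preact -(comp_assoc (act M) (tmap _ _ _)) tmapE (comp_assoc (act M)). Qed.

Lemma coinv_preactP M :
  tin T M (alg_one H) ∘ coinv_preact M = coact M ∘ coinv_preact M.
Proof.
apply: (tensor_ext (T := T)) => b.
rewrite -(comp_assoc (tin T M _)) -(comp_assoc (coact M)) coinv_preactE.
rewrite (comp_assoc (coact M)) coact_act_coinv -(comp_assoc _ (coact M)).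
by rewrite -(proj1 (coinv_morP M)) (comp_assoc (tmapl _ _ _)) tmaplE -(comp_assoc (tin T M _)).
Qed.

Definition coinv_act M : mor (tensor T (coinv_obj M) B) (coinv_obj M) :=
  coinv_lift (coinv_preactP M).

Lemma coinv_actE M :
  coinv_mor M ∘ coinv_act M = act M ∘ tmap T (coinv_mor M) (coinv_incl A).
Proof. exact: coinv_liftE. Qed.

Lemma coinv_act_tin M (b : B) :
  coinv_mor M ∘ (coinv_act M ∘ tin T _ b) =
  act M ∘ tin T M (coinv_incl A b) ∘ coinv_mor M.
Proof. by rewrite (comp_assoc (coinv_mor M)) coinv_liftE coinv_preactE. Qed.

Lemma coinv_actP M : is_action TV (coinv_act M).
Proof.
split; apply: coinv_mor_mono.
  by rewrite coinv_act_tin (action_one (actP M)) comp_idl comp_idr.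
apply: (tensor_ext (T := T)) => r; apply: (tensor_ext (T := T)) => s.
have -> : coinv_mor M ∘ (coinv_act M ∘ tmapl T (coinv_act M) B) ∘ tin T _ r ∘ tin T _ s
   = coinv_mor M ∘ (coinv_act M ∘ tin T _ r) ∘ (coinv_act M ∘ tin T _ s).
  rewrite -(comp_assoc (coinv_mor M)) -(comp_assoc (coinv_act M)) tmaplE.
  by rewrite (comp_assoc (coinv_act M)) !comp_assoc.
rewrite coinv_act_tin -(comp_assoc _ (coinv_mor M)) coinv_act_tin.
rewrite comp_assoc act_tin_mul.
rewrite -(comp_assoc (coinv_mor M)) -(comp_assoc (coinv_mor M)).
rewrite -(comp_assoc _ (tin T _ r)) -(comp_assoc _ (lassoc _ _ _ _ _)) lassocE.
by rewrite -(comp_assoc (coinv_act M)) tmaprE mulmapE coinv_act_tin.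
Qed.

Definition coinv_module M : module TV T B := Module (coinv_actP M).

Lemma coinv_fmap_subproof M N (f : mor (M : C) N) : is_hopf_hom f ->
  tin T N (alg_one H) ∘ (f ∘ coinv_mor M) = coact N ∘ (f ∘ coinv_mor M).
Proof.
move=> [_ fP]; rewrite (comp_assoc (coact N)) fP -(comp_assoc _ (coact M)).
rewrite -(proj1 (coinv_morP M)) (comp_assoc (tmapl _ _ _)) tmaplE.
by rewrite -(comp_assoc (tin T N _)).
Qed.

Definition coinv_fmap M N (f : mor (M : C) N) (fP : is_hopf_hom f) :
  mor (coinv_obj M) (coinv_obj N) := coinv_lift (coinv_fmap_subproof fP).

Lemma coinv_fmapE M N (f : mor (M : C) N) (fP : is_hopf_hom f) :
  coinv_mor N ∘ coinv_fmap fP = f ∘ coinv_mor M.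
Proof. exact: coinv_liftE. Qed.

Lemma coinv_fmapP M N (f : mor (M : C) N) (fP : is_hopf_hom f) :
  @is_module_hom _ _ _ _ _ (coinv_module M) (coinv_module N) (coinv_fmap fP).
Proof.
apply: coinv_mor_mono; apply: (tensor_ext (T := T)) => b.
rewrite (comp_assoc (coinv_mor N)) coinv_fmapE -(comp_assoc f) -(comp_assoc f).
rewrite -(comp_assoc (coinv_mor M)) coinv_act_tin.
rewrite -(comp_assoc (coinv_mor N)) -(comp_assoc (coinv_act N)) tmaplE.
rewrite (comp_assoc (coinv_act N)) (comp_assoc (coinv_mor N)) coinv_act_tin.
rewrite -(comp_assoc _ (coinv_mor N)) coinv_fmapE.
rewrite (comp_assoc f) (comp_assoc f) (proj1 fP) -(comp_assoc (act N)) tmaplE.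
by rewrite !comp_assoc.
Qed.

Definition coinv_functor : functor (hopf_module_category T A) (module_category TV T B).
Proof.
refine (@Functor (hopf_module_category T A) (module_category TV T B) coinv_module
  (fun M N f => exist _ _ (coinv_fmapP (proj2_sig f))) _ _).
- move=> M; apply: eq_exist; apply: coinv_mor_mono; transitivity (idm (M : C) ∘ coinv_mor M).
    exact: coinv_fmapE.
  by rewrite comp_idl comp_idr.
- move=> M N P g f; apply: eq_exist; apply: coinv_mor_mono.
  transitivity (proj1_sig g ∘ proj1_sig f ∘ coinv_mor M); first exact: coinv_fmapE.
  rewrite (comp_assoc (coinv_mor P)) coinv_fmapE -(comp_assoc (proj1_sig g)).
  by rewrite -[in RHS](comp_assoc (proj1_sig g)) coinv_fmapE.
Defined.

End Coinvariants.

(* Main.v *)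
(* Write F = C^H, with right adjoint G = HOM(A, -). F also has a left adjoint,
   N |-> A ⊗_B N, and cosemisimplicity makes its unit N -> (A ⊗_B N)^{co H} invertible:
   the average a |-> Σ a_0 φ(a_1) is a B-bilinear retraction s of B -> A, s ⊗_B N is
   inverse to the unit after restriction to coinvariants, since composed with the unit it
   is the average of A ⊗_B N. Hence F preserves monomorphisms and the counit F G -> 1 is
   invertible. The first fact makes G preserve injectives. Both make G preserve essential
   monomorphisms: if g ∘ G i is mono then so is F(g), and g is mono because the unit
   turns it into G F(g). So G carries injective envelopes to injective envelopes. *)
Require Import Defs.
From mathcomp Require Import all_boot all_algebra boolp.

Set Implicit Arguments.
Unset Strict Implicit.
Unset Printing Implicit Defensive.
Import GRing.Theory.

Local Open Scope ring_scope.

(** * Adjunctions, monomorphisms and injective envelopes *)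

Section Categories.
Variables C D : category.

(** Essentiality of [i] makes the comparison map [h] mono, so [h] splits because [E] is injective.
    Its retraction [r] satisfies [r ∘ i' = i], hence is mono too, and a mono retraction is a
    two-sided inverse. *)
Lemma injective_envelope_unique (X E E' : C) (i : mor X E) (i' : mor X E') :
  is_injective_envelope i -> is_injective_envelope i' -> isomorphic E E'.
Proof.
move=> [injE [mi ei]] [injE' [mi' ei']].
have [h hi] := injE' _ _ i i' mi.
have mh : mono h by apply: ei; rewrite hi.
have [r rh] := injE _ _ h (idm E) mh.
have mr : mono r by apply: ei'; rewrite -hi comp_assoc rh comp_idl.
exists h, r; split=> //; apply: mr.
by rewrite comp_assoc rh comp_idl comp_idr.
Qed.

Lemma isomorphic_trans (X Y Z : C) : isomorphic X Y -> isomorphic Y Z -> isomorphic X Z.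
Proof.
move=> [f [g [gf fg]]] [f' [g' [gf' fg']]]; exists (f' ∘ f), (g ∘ g'); split.
  by rewrite comp_assoc -(comp_assoc g) gf' comp_idr.
by rewrite comp_assoc -(comp_assoc f') fg comp_idr.
Qed.

Lemma fmap_isomorphic (F : functor C D) (X Y : C) :
  isomorphic X Y -> isomorphic (F X) (F Y).
Proof.
move=> [f [g [gf fg]]]; exists (fmap F f), (fmap F g).
by rewrite -!fmap_comp gf fg !fmap_id.
Qed.

(** [L] is the value at [N] of a left adjoint of [F], with invertible unit [eta]. The objectwise
    form spares the construction of that adjoint as a functor. *)
Definition universal_iso (F : functor C D) (N : D) (L : C) (eta : mor N (F L)) :=
  (exists r : mor (F L) N, r ∘ eta = idm N /\ eta ∘ r = idm (F L)) /\
  forall (M : C) (u : mor N (F M)), exists! h : mor L M, fmap F h ∘ eta = u.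

Variables (F : functor C D) (G : functor D C) (adj : adjunction F G).
Local Notation unit := (adj_unit adj).
Local Notation counit := (adj_counit adj).

Lemma adj_transpose (X : C) (Y : D) (f : mor X (G Y)) :
  fmap G (counit Y ∘ fmap F f) ∘ unit X = f.
Proof.
by rewrite fmap_comp -comp_assoc -adj_unit_nat comp_assoc adj_triangle_r comp_idl.
Qed.

Lemma adj_transposeV (X : C) (Y : D) (f : mor (F X) Y) :
  counit Y ∘ fmap F (fmap G f ∘ unit X) = f.
Proof.
by rewrite fmap_comp comp_assoc -adj_counit_nat -comp_assoc adj_triangle_l comp_idr.
Qed.

Lemma right_adjoint_mono (X Y : D) (f : mor X Y) : mono f -> mono (fmap G f).
Proof.
move=> mf Z g h gh; rewrite -(adj_transpose g) -(adj_transpose h).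
congr (fmap G _ ∘ _); apply: mf; rewrite !comp_assoc !adj_counit_nat.
by rewrite -!comp_assoc -!fmap_comp gh.
Qed.

Hypothesis HF : forall N : D, exists (L : C) (eta : mor N (F L)), universal_iso eta.

(** Here [F] acts as a right adjoint: by [HF], maps [Z -> F X] are maps [L -> X], naturally in
    [X]. *)
Lemma left_adjoint_mono (X Y : C) (f : mor X Y) : mono f -> mono (fmap F f).
Proof.
move=> mf Z g h gh; have [L [eta [_ univ]]] := HF Z.
have [g' [gE _]] := univ _ g; have [h' [hE _]] := univ _ h.
rewrite -gE -hE; congr (fmap F _ ∘ _); apply: mf.
have [w [_ uniq]] := univ _ (fmap F f ∘ g).
rewrite -(uniq (f ∘ g')); last by rewrite fmap_comp -comp_assoc gE.
by apply: uniq; rewrite fmap_comp -comp_assoc hE gh.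
Qed.

(* Via the universal isomorphism N' -> F L, both Hom(N', F G N) and Hom(N', N) are
   Hom(L, G N), compatibly with the counit. *)
Lemma counit_lift (N' N : D) (g : mor N' N) :
  exists! u : mor N' (F (G N)), counit N ∘ u = g.
Proof.
have [L [eta [[r [reta etar]] univ]]] := HF N'.
(* As [eta] is invertible, the equation says [counit N ∘ fmap F h = g ∘ r], so [h] must be the
   transpose of [g ∘ r]. *)
have transp (h : mor L (G N)) : counit N ∘ (fmap F h ∘ eta) = g ->
    h = fmap G (g ∘ r) ∘ unit L.
  by move=> <-; rewrite -!comp_assoc etar comp_idr adj_transpose.
exists (fmap F (fmap G (g ∘ r) ∘ unit L) ∘ eta); split.
  by rewrite comp_assoc adj_transposeV -comp_assoc reta comp_idr.
move=> u uE; have [h [hE _]] := univ _ u.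
by rewrite -hE; congr (fmap F _ ∘ _); rewrite -(transp h) // hE.
Qed.

(** The inverse is the lift of the identity. The composite in the other order and the identity both
    lift [counit N], so they agree. *)
Lemma counit_iso (N : D) :
  exists r : mor N (F (G N)), counit N ∘ r = idm N /\ r ∘ counit N = idm (F (G N)).
Proof.
have [r [rE _]] := counit_lift (idm N); exists r; split=> //.
have [u [_ uniq]] := counit_lift (counit N).
rewrite -(uniq (idm _)) ?comp_idr //; symmetry; apply: uniq.
by rewrite comp_assoc rE comp_idl.
Qed.

Lemma unit_mono (N : D) : mono (unit (G N)).
Proof.
move=> Z g h gh.
by rewrite -[g]comp_idl -[h]comp_idl -(adj_triangle_r adj) -!comp_assoc gh.
Qed.

Lemma right_adjoint_injective (E : D) : injective_object E -> injective_object (G E).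
Proof.
move=> injE X Y f g mf.
have [h hE] := injE _ _ _ (counit E ∘ fmap F g) (left_adjoint_mono mf).
exists (fmap G h ∘ unit Y).
by rewrite -comp_assoc adj_unit_nat comp_assoc -fmap_comp hE adj_transpose.
Qed.

Lemma right_adjoint_essential (N E : D) (i : mor N E) :
  essential_mono i -> essential_mono (fmap G i).
Proof.
move=> [mi ei]; split=> [|Y g mg]; first exact: right_adjoint_mono.
have [r [cr rc]] := counit_iso E; have [s [cs sc]] := counit_iso N.
(* Naturality of the inverse counits. *)
have natE : fmap F (fmap G i) ∘ s = r ∘ i.
  rewrite -[LHS]comp_idl -rc -comp_assoc; congr (_ ∘ _).
  by rewrite comp_assoc -adj_counit_nat -comp_assoc cs comp_idr.
(* By [natE], composing with [i] gives [F(g ∘ G i) ∘ s], which is mono; essentiality of [i] then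
   applies. *)
have mFg : mono (fmap F g ∘ r).
  apply: ei => Z a b; rewrite -!(comp_assoc (fmap F g)) -!natE.
  rewrite !(comp_assoc (fmap F g)) -fmap_comp -!(comp_assoc _ s).
  move=> /(left_adjoint_mono mg) /(congr1 (fun f => counit N ∘ f)).
  by rewrite !comp_assoc cs !comp_idl.
have mGFg : mono (fmap F g).
  move=> Z a b ab; rewrite -[a]comp_idl -[b]comp_idl -rc -!comp_assoc.
  by congr (_ ∘ _); apply: mFg; rewrite -!(comp_assoc _ r) !(comp_assoc r) rc !comp_idl.
(* Naturality turns [unit Y ∘ g] into [G(F g) ∘ unit (G E)], a composite of monos. *)
move=> Z a b ab; apply: (@unit_mono E); apply: (right_adjoint_mono mGFg).
by rewrite !comp_assoc -adj_unit_nat -!comp_assoc ab.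
Qed.

Lemma right_adjoint_injective_envelope (N E : D) (i : mor N E) :
  is_injective_envelope i -> is_injective_envelope (fmap G i).
Proof.
move=> [injE essi].
by split; [apply: right_adjoint_injective | apply: right_adjoint_essential].
Qed.

End Categories.

(** * Calculating with generalised elements of tensor products *)

Section LinearFamilies.
Variables (k : fieldType) (C : lincat k).

Lemma grothendieck_coequalizer (hC : is_grothendieck C) (X Y : C) (f g : mor X Y) :
  exists (Q : C) (q : mor Y Q), q ∘ f = q ∘ g /\
    forall (W : C) (t : mor Y W), t ∘ f = t ∘ g -> exists! u : mor Q W, u ∘ q = t.
Proof.
have eqE W (t : mor Y W) : t ∘ f = t ∘ g <->
    t ∘ ((f : lhom X Y) - (g : lhom X Y) : mor X Y) = zero_mor X W.
  have -> : t ∘ ((f : lhom X Y) - (g : lhom X Y) : mor X Y) =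
      (t ∘ f : lhom X W) - (t ∘ g : lhom X W).
    by have := @lcomp_linearr _ C _ _ _ t (-1) g f; rewrite !scaleN1r ![- _ + _]addrC.
  by split=> [->|/eqP]; [rewrite subrr | rewrite subr_eq0 => /eqP].
have [Q [q [/eqE qf univ]]] :=
  ab_cokernel (gr_abelian hC) ((f : lhom X Y) - (g : lhom X Y) : mor X Y).
by exists Q, q; split=> // W t /eqE; apply: univ.
Qed.

Lemma comp_linear_l (V : lmodType k) (X Y Z : C) (f : V -> lhom Y Z) (g : lhom X Y) :
  linear f -> linear (fun v => lcomp (f v) g).
Proof. by move=> lf a u v; rewrite lf lcomp_linearl. Qed.

Lemma comp_linear_r (V : lmodType k) (X Y Z : C) (f : V -> lhom X Y) (h : lhom Y Z) :
  linear f -> linear (fun v => lcomp h (f v)).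
Proof. by move=> lf a u v; rewrite lf lcomp_linearr. Qed.

Variables (TV : tensoring (modk k)) (T : tensoring C).

Lemma tin_comp_linear (U V : lmodType k) (M : C) (f : U -> V) :
  linear f -> linear (fun u => tin T M (f u) : lhom M (tensor T M V)).
Proof. by move=> lf a u v; rewrite lf tin_linear. Qed.

(** Plays the part of Sweedler notation: once a coaction such as [ca_coact A a] is generalised to an
    arbitrary tensor, an identity linear in it is checked on pure tensors. *)
Lemma vtensor_eq (V W U : lmodType k) (f g : vtensor TV V W -> U) :
  linear f -> linear g -> (forall v w, f (pure TV v w) = g (pure TV v w)) ->
  forall x, f x = g x.
Proof.
move=> lf lg fg x.
by rewrite -[f]/(mklin lf : _ -> _) (_ : mklin lf = mklin lg) //; apply: vtensor_ext.
Qed.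

Lemma vtensor_mor_eq (V W : lmodType k) (X Y : C) (f g : vtensor TV V W -> mor X Y) :
  linear (f : _ -> lhom X Y) -> linear (g : _ -> lhom X Y) ->
  (forall v w, f (pure TV v w) = g (pure TV v w)) -> forall x, f x = g x.
Proof. exact: vtensor_eq. Qed.

(** In this and the similar variants below, [x] is the tail of a right-nested composite, so
    rewriting works as on generalised elements. *)
Lemma tmaplEr (M N X : C) (V : lmodType k) (f : mor M N) (v : V) (x : mor X M) :
  tmapl T f V ∘ (tin T M v ∘ x) = tin T N v ∘ (f ∘ x).
Proof. by rewrite comp_assoc tmaplE -comp_assoc. Qed.

Lemma tmaprEr (M X : C) (V W : lmodType k) (g : {linear V -> W}) (v : V) (x : mor X M) :
  tmapr T M g ∘ (tin T M v ∘ x) = tin T M (g v) ∘ x.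
Proof. by rewrite comp_assoc tmaprE. Qed.

Lemma tmapEr (M N X : C) (V W : lmodType k) (f : mor M N) (g : {linear V -> W}) (v : V)
    (x : mor X M) :
  tmap T f g ∘ (tin T M v ∘ x) = tin T N (g v) ∘ (f ∘ x).
Proof. by rewrite comp_assoc tmapE -comp_assoc. Qed.

Lemma rassocEr (M X : C) (V W : lmodType k) (v : V) (w : W) (x : mor X M) :
  rassoc TV T M V W ∘ (tin T _ w ∘ (tin T M v ∘ x)) = tin T M (pure TV v w) ∘ x.
Proof. by rewrite -(rassocE TV T) -!comp_assoc. Qed.

Lemma lassocEr (M X : C) (V W : lmodType k) (v : V) (w : W) (x : mor X M) :
  lassoc TV T M V W ∘ (tin T _ w ∘ (tin T M v ∘ x)) = tin T M (pure TV w v) ∘ x.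
Proof. by rewrite -(lassocE TV T) -!comp_assoc. Qed.

Lemma middle_swapEr (M X : C) (U V W : lmodType k) (u : U) (v : V) (w : W) (x : mor X M) :
  middle_swap TV T M U V W ∘ (tin T _ (pure TV v w) ∘ (tin T M u ∘ x)) =
  tin T _ (pure TV w u) ∘ (tin T M v ∘ x).
Proof. by rewrite !comp_assoc -(middle_swapE TV T) !comp_assoc. Qed.

Lemma tcontractE (M : C) (V : lmodType k) (phi : {linear V -> k^o}) (v : V) :
  tcontract T M phi ∘ tin T M v = (phi v : k) *: (idm M : lhom M M).
Proof. exact: tdescE. Qed.

Lemma scale_compl (X Y Z : C) (a : k) (f : lhom Y Z) (g : lhom X Y) :
  lcomp (a *: f) g = a *: lcomp f g.
Proof. exact: (linearZ_LR (mklin (@lcomp_linearl _ C _ _ _ g))). Qed.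

Lemma scale_compr (X Y Z : C) (a : k) (f : lhom Y Z) (g : lhom X Y) :
  lcomp f (a *: g) = a *: lcomp f g.
Proof. exact: (linearZ_LR (mklin (@lcomp_linearr _ C _ _ _ f))). Qed.

Lemma tcontractEr (M X : C) (V : lmodType k) (phi : {linear V -> k^o}) (v : V)
    (x : lhom X M) :
  tcontract T M phi ∘ (tin T M v ∘ x) = (phi v : k) *: x.
Proof. by rewrite comp_assoc tcontractE [LHS]scale_compl lcomp_idl. Qed.

(* "m ⊗ (v ⊗ w) |-> g (m ⊗ v) ⊗ w" *)
Definition tmapl_assoc (M X : C) (V W : lmodType k) (g : mor (tensor T M V) X) :
  mor (tensor T M (vtensor TV V W)) (tensor T X W) :=
  tmapl T g W ∘ rassoc_inv TV T M V W.

Lemma tmapl_assocE (M X : C) (V W : lmodType k) (g : mor (tensor T M V) X) v w :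
  tmapl_assoc W g ∘ tin T M (pure TV v w) = tin T X w ∘ (g ∘ tin T M v).
Proof. by rewrite /tmapl_assoc -comp_assoc rassoc_invE tmaplEr. Qed.

Lemma tinZ (M : C) (V : lmodType k) (c : k) (v : V) :
  tin T M (c *: v) = c *: (tin T M v : lhom _ _).
Proof. exact: (linearZ_LR (tin_lin T M V)). Qed.

End LinearFamilies.

(** * Pure tensors of vector spaces *)

Section VectorSpaces.
Variables (k : fieldType) (TV : tensoring (modk k)).

Lemma tensor_mul_linear_l (R R' : algebra k) (t : vtensor TV R R') :
  linear (fun s => tensor_mul s t).
Proof. by move=> a u v; rewrite /tensor_mul linearP. Qed.

Lemma tensor_mul_linear_r (R R' : algebra k) (s : vtensor TV R R') :
  linear (tensor_mul s).
Proof. by move=> a u v; rewrite /tensor_mul linearP. Qed.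

Lemma comp_linear (U V W : lmodType k) (f : U -> V) (g : V -> W) :
  linear f -> linear g -> linear (fun u => g (f u)).
Proof. by move=> lf lg a u v; rewrite lf lg. Qed.

Lemma vtcontractE (V W : lmodType k) (phi : {linear W -> k^o}) (v : V) (w : W) :
  (tcontract TV (V : modk k) phi : {linear _ -> _}) (pure TV v w) = (phi w : k) *: v.
Proof. exact: (congr1 (fun f : {linear V -> V} => f v) (@tcontractE k (modk k) TV V W phi w)). Qed.

Lemma slicerE (V W : lmodType k) (f : {linear W -> k^o}) (v : V) (w : W) :
  slicer TV V f (pure TV v w) = (f w : k) *: v.
Proof. exact: bilin_descE. Qed.

Lemma pureZl (V W : lmodType k) (c : k) (v : V) (w : W) :
  pure TV (c *: v) w = c *: pure TV v w.
Proof. exact: (linearZ_LR (mklin (pure_linearl TV (V := V) w))). Qed.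

Lemma pureZr (V W : lmodType k) (c : k) (v : V) (w : W) :
  pure TV v (c *: w) = c *: pure TV v w.
Proof. exact: (linearZ_LR (mklin (pure_linearr TV (W := W) v))). Qed.

Lemma vassocE (U V W : lmodType k) (u : U) (v : V) (w : W) :
  vassoc TV U V W (pure TV (pure TV u v) w) = pure TV u (pure TV v w).
Proof.
exact: (congr1 (fun f : {linear U -> _} => f u) (rassocE TV TV (U : modk k) v w)).
Qed.

End VectorSpaces.

(* Syntactic, whereas "rewrite -!comp_assoc" would unfold tdesc, tmapl, etc. *)
Ltac right_nest :=
  repeat match goal with
  | |- context [?h ∘ ?g ∘ ?f] => rewrite -(comp_assoc h g f)
  end.

(** * The relative tensor product [A ⊗_B N] as a Hopf module *)

Section RelativeTensor.
Variables (k : fieldType) (TV : tensoring (modk k)).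
Variables (S : lincat k) (hS : is_grothendieck S) (T : tensoring S).
Variables (H : hopf_algebra TV) (A : comodule_algebra H).
Local Notation B := (coinv_alg A).
Local Notation incl := (coinv_incl A).
Variable N : module TV T B.

(** The [B]-balanced maps, which are those that factor through [A ⊗_B N]. *)
Definition balanced (X : S) (g : mor (tensor T N A) X) :=
  forall (a : A) (b : B),
    g ∘ tin T N (a ⋅ incl b) = g ∘ (tin T N a ∘ (act N ∘ tin T N b)).

(** A coequalizer of two maps [(N ⊗ B) ⊗ A -> N ⊗ A]: one multiplies [B] into [A] from the right,
    the other lets [B] act on [N]. *)
Lemma relative_tensor_exists :
  exists (Q : S) (q : mor (tensor T N A) Q), balanced q /\
    forall (X : S) (g : mor (tensor T N A) X), balanced g -> exists! u : mor Q X, u ∘ q = g.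
Proof.
pose m : {linear vtensor TV A B -> A} := mulmap TV A \o vtmap TV idfun incl.
have mE a b : m (pure TV a b) = a ⋅ incl b.
  by transitivity (mulmap TV A (vtmap TV idfun incl (pure TV a b)));
    last by rewrite vtmapE mulmapE.
have balE (X : S) (g : mor (tensor T N A) X) : balanced g <->
    g ∘ (tmapr T N m ∘ lassoc TV T N B A) = g ∘ tmapl T (act N) A.
  split=> [bal|eq_g a b].
    apply: (tensor_ext (T := T)) => a; apply: (tensor_ext (T := T)) => b.
    right_nest; rewrite lassocE tmaprE tmaplEr mE; exact: bal.
  have /(congr1 (fun h => h ∘ (tin T _ a ∘ tin T N b))) := eq_g.
  by right_nest; rewrite lassocE tmaprE tmaplEr mE.
have [Q [q [qE univ]]] := grothendieck_coequalizer hS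
  (tmapr T N m ∘ lassoc TV T N B A) (tmapl T (act N) A).
by exists Q, q; split=> [|X g /balE]; [apply/balE | apply: univ].
Qed.

(* The object A ⊗_B N; rel_proj is "n ⊗ a |-> a ⊗_B n". *)
Definition rel_obj : S := proj1_sig (cid relative_tensor_exists).

Definition rel_proj : mor (tensor T N A) rel_obj :=
  proj1_sig (cid (proj2_sig (cid relative_tensor_exists))).
Local Notation q := rel_proj.

Let rel_projP := proj2_sig (cid (proj2_sig (cid relative_tensor_exists))).

Lemma rel_balanced : balanced q.
Proof. exact: proj1 rel_projP. Qed.

Definition rel_desc (X : S) (g : mor (tensor T N A) X) (bg : balanced g) : mor rel_obj X :=
  proj1_sig (cid (proj2 rel_projP X g bg)).

Lemma rel_descE (X : S) (g : mor (tensor T N A) X) (bg : balanced g) :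
  rel_desc bg ∘ q = g.
Proof. exact: (proj1 (proj2_sig (cid (proj2 rel_projP X g bg)))). Qed.

Lemma rel_descEr (X Y : S) (g : mor (tensor T N A) X) (bg : balanced g)
    (x : mor Y (tensor T N A)) : rel_desc bg ∘ (q ∘ x) = g ∘ x.
Proof. by rewrite comp_assoc rel_descE. Qed.

Lemma rel_epi : epi q.
Proof.
move=> X g h gh; have bg : balanced (g ∘ q).
  by move=> a b; right_nest; rewrite rel_balanced.
by have [u [_ uniq]] := proj2 rel_projP X _ bg; rewrite -(uniq g) // (uniq h).
Qed.

Lemma rel_ext (X : S) (g h : mor rel_obj X) :
  (forall a, g ∘ (q ∘ tin T N a) = h ∘ (q ∘ tin T N a)) -> g = h.
Proof.
move=> gh; apply: rel_epi; apply: (tensor_ext (T := T)) => a.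
by right_nest; rewrite gh.
Qed.

Fact lmul_linear (a : A) : linear (fun c : A => a ⋅ c).
Proof. exact: alg_linearr. Qed.

(** Left multiplication by [a] commutes with right multiplication by [B], so it descends to
    [A ⊗_B N]. *)
Fact rel_preact_balanced (a : A) : balanced (q ∘ tmapr T N (mklin (lmul_linear a))).
Proof.
move=> c b; right_nest; rewrite tmaprE tmaprEr /= alg_mulA; exact: rel_balanced.
Qed.

Definition rel_lmul (a : A) : mor rel_obj rel_obj := rel_desc (rel_preact_balanced a).

Lemma rel_lmulE (a c : A) : rel_lmul a ∘ (q ∘ tin T N c) = q ∘ tin T N (a ⋅ c).
Proof. by rewrite rel_descEr -comp_assoc tmaprE. Qed.

Fact rel_lmul_linear : linear (rel_lmul : A -> lhom rel_obj rel_obj).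
Proof.
move=> t a b; apply: rel_ext => c; rewrite rel_lmulE alg_linearl tin_linear.
rewrite [RHS]lcomp_linearl [LHS]lcomp_linearr.
by congr (_ *: _ + _); symmetry; apply: rel_lmulE.
Qed.

Definition rel_act : mor (tensor T rel_obj A) rel_obj := tdesc T (mklin rel_lmul_linear).

Lemma rel_actE (a c : A) :
  rel_act ∘ (tin T _ a ∘ (q ∘ tin T N c)) = q ∘ tin T N (a ⋅ c).
Proof. by rewrite comp_assoc tdescE rel_lmulE. Qed.

Lemma rel_actP : is_action TV rel_act.
Proof.
split.
  by apply: rel_ext => a; rewrite -comp_assoc rel_actE alg_mul1l comp_idl.
apply: (tensor_ext (T := T)) => a; apply: (tensor_ext (T := T)) => b.
apply: rel_ext => c; right_nest; rewrite tmaplEr rel_actE rel_actE.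
by rewrite lassocEr tmaprEr mulmapE rel_actE alg_mulA.
Qed.

Definition rel_module : module TV T A := Module rel_actP.

Local Notation qH := (tmapl_assoc TV H q).

Let qH_linear (X : S) (x : mor X N) :
  linear (fun s : vtensor TV A H => qH ∘ (tin T N s ∘ x) : lhom X (tensor T rel_obj H)).
Proof. by apply: comp_linear_r; apply: comp_linear_l; apply: tin_linear. Qed.

Let qHE (X : S) (x : mor X N) a h :
  qH ∘ (tin T N (pure TV a h) ∘ x) = tin T rel_obj h ∘ (q ∘ (tin T N a ∘ x)).
Proof. by rewrite comp_assoc tmapl_assocE -!comp_assoc. Qed.

(** Elements of [B] coact as [b ⊗ 1], so the coaction of [A] is right [B]-linear and induces
    [a ⊗_B n |-> (a_0 ⊗_B n) ⊗ a_1]. *)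
Fact rel_precoact_balanced : balanced (qH ∘ tmapr T N (ca_coact A)).
Proof.
move=> a b; right_nest; rewrite tmaprE tmaprEr ca_mul.
have -> : ca_coact A (incl b) = pure TV (incl b) (alg_one H).
  by apply/coinvP; apply: coinv_valP.
(* The added identity gives the left side the shape required by [qH_linear]. *)
rewrite -[LHS]comp_idr -comp_assoc; move: (ca_coact A a).
apply: vtensor_mor_eq.
- exact: (comp_linear (tensor_mul_linear_l _) (qH_linear _)).
- exact: qH_linear.
move=> c h; rewrite tensor_mulE alg_mul1r !qHE comp_idr; congr (_ ∘ _).
exact: rel_balanced.
Qed.

Definition rel_coact : mor rel_obj (tensor T rel_obj H) := rel_desc rel_precoact_balanced.

Lemma rel_coactE (a : A) : rel_coact ∘ (q ∘ tin T N a) = qH ∘ tin T N (ca_coact A a).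
Proof. by rewrite rel_descEr -comp_assoc tmaprE. Qed.

Let qH_lin (X : S) (g : mor (tensor T rel_obj H) X) :
  linear (fun s : vtensor TV A H => g ∘ (qH ∘ tin T N s) : lhom (N : S) X).
Proof. by apply: comp_linear_r; apply: comp_linear_r; apply: tin_linear. Qed.

Lemma coact_algE (a : A) :
  (tcontract TV (A : modk k) (counit H) : {linear _ -> _}) (ca_coact A a) = a.
Proof.
exact: (congr1 (fun f : {linear A -> A} => f a) (coaction_counit (ca_coactP A))).
Qed.

(** The axiom for [A] is an equation of morphisms in [modk]; this is its value at an element, in the
    form of [Delta_coassoc]. *)
Lemma coact_alg_coassoc (a : A) :
  vassoc TV A H H (vtmap TV (ca_coact A) idfun (ca_coact A a)) =
  vtmap TV idfun (Delta H) (ca_coact A a).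
Proof.
have /(congr1 (fun f : {linear A -> _} => f a)) := coaction_coassoc (ca_coactP A).
move=> E; transitivity
  ((rassoc TV TV (A : modk k) H H : {linear _ -> _})
    ((tmapl TV (ca_coact A : mor (A : modk k) _) H : {linear _ -> _}) (ca_coact A a))).
  congr (_ _); apply: vtensor_eq; try exact: linearP.
  move=> c h; rewrite vtmapE; symmetry.
  exact: (congr1 (fun f : {linear A -> _} => f c) (tmaplE TV (ca_coact A : mor (A : modk k) _) h)).
transitivity ((tmapr TV (A : modk k) (Delta H) : {linear _ -> _}) (ca_coact A a)); first exact: E.
apply: vtensor_eq; try exact: linearP.
move=> c h; rewrite vtmapE.
exact: (congr1 (fun f : {linear A -> _} => f c) (tmaprE TV (A : modk k) (Delta H) h)).
Qed.

Lemma rel_coactP : is_coaction rel_coact.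
Proof.
split; apply: rel_ext => a; right_nest; rewrite rel_coactE.
  rewrite comp_idl -[in RHS](coact_algE a); move: (ca_coact A a).
  apply: vtensor_mor_eq; first exact: qH_lin.
    apply: comp_linear_r; apply: tin_comp_linear; exact: linearP.
  move=> c h; rewrite tmapl_assocE tcontractEr vtcontractE.
  by rewrite tinZ [RHS]scale_compr.
(* Both sides of coassociativity are [J] applied to the corresponding sides for [A]. *)
pose J := tmapl_assoc TV (vtensor TV H H) q.
transitivity (J ∘ tin T N (vtmap TV idfun (Delta H) (ca_coact A a))); last first.
  move: (ca_coact A a); apply: vtensor_mor_eq; last first.
  - by move=> c h; rewrite vtmapE !tmapl_assocE tmaprEr.
  - exact: qH_lin.
  - apply: comp_linear_r; apply: tin_comp_linear; exact: linearP.
rewrite -coact_alg_coassoc; move: (ca_coact A a); apply: vtensor_mor_eq.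
- by do 3!apply: comp_linear_r; apply: tin_linear.
- apply: comp_linear_r; apply: tin_comp_linear; apply: comp_linear; exact: linearP.
move=> c h; rewrite tmapl_assocE tmaplEr rel_coactE vtmapE; move: (ca_coact A c).
apply: vtensor_mor_eq.
- by do 3!apply: comp_linear_r; apply: tin_linear.
- apply: comp_linear_r; apply: tin_comp_linear; apply: comp_linear; last exact: linearP.
  exact: pure_linearl.
move=> c' h'; rewrite tmapl_assocE rassocEr vassocE.
by rewrite tmapl_assocE.
Qed.

(** Reduces to multiplicativity of the coaction of [A]; both sides are linear in each of the two
    coactions, which may thus be taken pure one after the other. *)
Lemma rel_coact_act :
  rel_coact ∘ rel_act =
  tmap T rel_act (mulmap TV H) ∘ middle_swap TV T rel_obj H A H ∘
  tmap T rel_coact (ca_coact A).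
Proof.
apply: (tensor_ext (T := T)) => a; apply: rel_ext => c; right_nest.
rewrite rel_actE rel_coactE ca_mul tmapEr rel_coactE.
move: (ca_coact A a) (ca_coact A c) => s t; move: s; apply: vtensor_mor_eq.
- apply: comp_linear_r; apply: tin_comp_linear; exact: tensor_mul_linear_l.
- by do 2!apply: comp_linear_r; apply: comp_linear_l; apply: tin_linear.
move=> a1 h1; move: t; apply: vtensor_mor_eq.
- apply: comp_linear_r; apply: tin_comp_linear; exact: tensor_mul_linear_r.
- by do 3!apply: comp_linear_r; apply: comp_linear_r; apply: tin_linear.
move=> a0 h0; rewrite tensor_mulE !tmapl_assocE middle_swapEr tmapEr mulmapE.
by rewrite rel_actE.
Qed.

Definition rel_hopf_module : hopf_module T A :=
  @HopfModule _ _ _ _ _ _ rel_module rel_coact rel_coactP rel_coact_act.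

Local Notation F := (coinv_functor T A hS).
Local Notation Q := rel_hopf_module.

Lemma coinv_act_tinr (M : hopf_module T A) (X : S) (x : mor X (coinv_obj hS M)) (b : B) :
  coinv_mor hS M ∘ (act (coinv_module hS M) ∘ (tin T (coinv_module hS M) b ∘ x)) =
  act M ∘ (tin T M (incl b) ∘ (coinv_mor hS M ∘ x)).
Proof.
transitivity (coinv_mor hS M ∘ (coinv_act hS M ∘ tin T _ b) ∘ x).
  by rewrite -(comp_assoc (coinv_mor hS M)) -(comp_assoc (coinv_act hS M)).
by rewrite coinv_act_tin; right_nest.
Qed.

Lemma rel_unit_coinv :
  tin T Q (alg_one H) ∘ (q ∘ tin T N (alg_one A)) = coact Q ∘ (q ∘ tin T N (alg_one A)).
Proof. by rewrite rel_coactE ca_one tmapl_assocE. Qed.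

Definition rel_unit_mor : mor (N : S) (coinv_obj hS Q) := coinv_lift hS rel_unit_coinv.

Lemma rel_unit_morE : coinv_mor hS Q ∘ rel_unit_mor = q ∘ tin T N (alg_one A).
Proof. exact: coinv_liftE. Qed.

(** Amounts to [1 ⊗_B bn = b ⊗_B n], which is balancedness at [a = 1]. *)
Lemma rel_unit_hom : @is_module_hom _ _ _ _ _ N (coinv_module hS Q) rel_unit_mor.
Proof.
rewrite /is_module_hom; apply: (coinv_mor_mono (hC := hS)).
apply: (tensor_ext (T := T)) => b; right_nest.
rewrite tmaplE coinv_act_tinr (comp_assoc (coinv_mor hS Q)) rel_unit_morE; right_nest.
rewrite rel_actE alg_mul1r -(rel_balanced (alg_one A) b).
by rewrite alg_mul1l.
Qed.

Definition rel_unit : mor (N : module_category TV T B) (F Q) :=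
  exist _ rel_unit_mor rel_unit_hom.

(** * The universal property of the unit [n |-> 1 ⊗_B n] *)

Section UniversalProperty.
Variables (M : hopf_module T A) (v : mor (N : S) (M : S)).
Hypothesis v_coinv : tin T M (alg_one H) ∘ v = coact M ∘ v.
Hypothesis v_lin : forall b : B, v ∘ (act N ∘ tin T N b) = act M ∘ (tin T M (incl b) ∘ v).

Fact rel_ext_balanced : balanced (act M ∘ tmapl T v A).
Proof.
move=> a b; right_nest; rewrite tmaplE tmaplEr v_lin.
rewrite (comp_assoc (act M)) -(act_tin_mul M); right_nest; by [].
Qed.

Definition rel_extend : mor (rel_hopf_module : S) (M : S) := rel_desc rel_ext_balanced.

Lemma rel_extendE (a : A) : rel_extend ∘ (q ∘ tin T N a) = act M ∘ (tin T M a ∘ v).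
Proof. by rewrite rel_descEr -comp_assoc tmaplE. Qed.

(** Linearity is associativity of the action. For colinearity, [v(n)] is coinvariant, so [a v(n)]
    coacts as [a_0 v(n) ⊗ a_1]. *)
Lemma rel_extend_hom : is_hopf_hom (M := Q) (N := M) rel_extend.
Proof.
split.
  apply: (tensor_ext (T := T)) => a; apply: rel_ext => c; right_nest.
  rewrite rel_actE rel_extendE tmaplEr rel_extendE.
  by rewrite (comp_assoc (act M)) -(act_tin_mul M); right_nest.
apply: rel_ext => a; right_nest; rewrite rel_extendE rel_coactE.
rewrite (comp_assoc (coact M)) coact_act; right_nest.
rewrite tmapEr -v_coinv; move: (ca_coact A a); apply: vtensor_mor_eq.
- by do 2!apply: comp_linear_r; apply: comp_linear_l; apply: tin_linear.
- by do 2!apply: comp_linear_r; apply: tin_linear.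
move=> c h; rewrite middle_swapEr tmapEr mulmapE alg_mul1r.
by rewrite tmapl_assocE tmaplEr rel_extendE.
Qed.

(** The elements [1 ⊗_B n] generate [A ⊗_B N] over [A], so linearity alone determines [h]. *)
Lemma rel_extend_unique (h : mor (Q : S) (M : S)) :
  is_module_hom (M := Q) (N := M) h -> h ∘ (q ∘ tin T N (alg_one A)) = v -> h = rel_extend.
Proof.
move=> h_lin hv; apply: rel_ext => a; rewrite rel_extendE -hv -{1}[a]alg_mul1r.
by rewrite -rel_actE (comp_assoc h) h_lin; right_nest; rewrite tmaplEr.
Qed.

End UniversalProperty.

Lemma rel_universal (M : hopf_module_category T A)
    (u : mor (N : module_category TV T B) (F M)) :
  exists! h : mor (Q : hopf_module_category T A) M, fmap F h ∘ rel_unit = u.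
Proof.
case: u => u u_lin.
(* As [coinv_mor] is an equalizer, [u] amounts to a [B]-linear map [v] into [M] with coinvariant
   values. *)
pose v := coinv_mor hS M ∘ u.
have v_coinv : tin T M (alg_one H) ∘ v = coact M ∘ v.
  by rewrite (comp_assoc (tin T M _)) (proj1 (coinv_morP hS M)) comp_assoc.
have v_lin (b : B) : v ∘ (act N ∘ tin T N b) = act M ∘ (tin T M (incl b) ∘ v).
  rewrite /v; right_nest.
  rewrite (comp_assoc u) u_lin -(comp_assoc (act _)) tmaplE.
  exact: coinv_act_tinr.
have unitE (h : mor (Q : hopf_module_category T A) M) :
    coinv_mor hS M ∘ (proj1_sig (fmap F h) ∘ rel_unit_mor) =
    proj1_sig h ∘ (q ∘ tin T N (alg_one A)).
  by rewrite comp_assoc coinv_fmapE -comp_assoc rel_unit_morE.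
exists (exist _ _ (rel_extend_hom v_coinv v_lin)); split.
  apply: eq_exist; apply: (coinv_mor_mono (hC := hS)); rewrite [LHS]unitE.
  rewrite [LHS](rel_extendE v_lin) comp_assoc (action_one (actP M)); exact: comp_idl.
move=> [h hP] hu; apply: eq_exist; symmetry; apply: rel_extend_unique; first exact: hP.1.
rewrite -(unitE (exist _ h hP)); congr (_ ∘ _).
exact: (congr1 (@proj1_sig _ _) hu).
Qed.

(** * Averaging by the integral, and invertibility of the unit *)

Section Averaging.
Variable phi : {linear H -> k^o}.
Hypotheses (phi_int : left_integral phi) (phi1 : phi (alg_one H) = 1 :> k).

Definition average (a : A) : A := slicer TV _ phi (ca_coact A a).

Fact average_linear : linear average.
Proof. by move=> t a b; rewrite /average !linearP. Qed.

(** By coassociativity the average coacts as [a_0 ⊗ a_1 φ(a_2)], and the left integral property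
    turns this into [a_0 φ(a_1) ⊗ 1]. *)
Lemma average_coinv (a : A) : average a \in @coinv_pred k TV H A.
Proof.
apply/coinvP; transitivity
  (vtmap TV idfun (slicer TV _ phi) (vassoc TV A H H (vtmap TV (ca_coact A) idfun (ca_coact A a)))).
  rewrite /average; move: (ca_coact A a); apply: vtensor_eq.
  - by move=> t x y; rewrite !linearP.
  - by move=> t x y; rewrite !linearP.
  move=> c h; rewrite slicerE linearZ_LR vtmapE; move: (ca_coact A c); apply: vtensor_eq.
  - by move=> t x y; rewrite scalerDr !scalerA mulrC.
  - by move=> t x y; rewrite pure_linearl !linearP.
  by move=> c' h'; rewrite vassocE vtmapE slicerE pureZr.
rewrite coact_alg_coassoc /average; move: (ca_coact A a); apply: vtensor_eq.
- by move=> t x y; rewrite !linearP.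
- by move=> t x y; rewrite linearP pure_linearl.
by move=> c h; rewrite !vtmapE phi_int slicerE pureZl pureZr.
Qed.

Definition average_lin (a : A) : B := Coinv (average_coinv a).

Fact average_lin_linear : linear average_lin.
Proof. by move=> t a b; apply: val_inj; apply: average_linear. Qed.

Lemma average_mul (a : A) (b : B) : average_lin (a ⋅ incl b) = average_lin a ⋅ b.
Proof.
apply: val_inj; rewrite /= /average ca_mul.
have -> : ca_coact A (incl b) = pure TV (incl b) (alg_one H).
  by apply/coinvP; apply: coinv_valP.
move: (ca_coact A a); apply: vtensor_eq.
- by move=> t x y; rewrite tensor_mul_linear_l linearP.
- by move=> t x y; rewrite linearP alg_linearl.
move=> c h; rewrite tensor_mulE !slicerE alg_mul1r.
by rewrite -[LHS](linearZ_LR (mklin (alg_linearl (incl b)))).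
Qed.

Lemma average_one : average_lin (alg_one A) = alg_one B.
Proof. by apply: val_inj; rewrite /= /average ca_one slicerE phi1 scale1r. Qed.

Fact average_act_linear :
  linear (fun a : A => act N ∘ tin T N (average_lin a) : lhom (N : S) (N : S)).
Proof. by apply: comp_linear_r; apply: tin_comp_linear; apply: average_lin_linear. Qed.

Fact average_balanced : balanced (tdesc T (mklin average_act_linear)).
Proof.
move=> a b; rewrite [RHS]comp_assoc !tdescE.
transitivity (act N ∘ tin T N (average_lin a ⋅ b)); first by rewrite -average_mul.
by rewrite -(act_tin_mul N).
Qed.

(** The map [s ⊗_B N], for [s] the average regarded as a map [A -> B]. *)
Definition rel_retract : mor rel_obj N := rel_desc average_balanced.

Lemma rel_retractE (a : A) :
  rel_retract ∘ (q ∘ tin T N a) = act N ∘ tin T N (average_lin a).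
Proof. by rewrite rel_descEr tdescE. Qed.

Lemma rel_retract_unit : rel_retract ∘ coinv_mor hS Q ∘ rel_unit_mor = idm (N : S).
Proof.
rewrite -comp_assoc rel_unit_morE rel_retractE average_one.
exact: (action_one (actP N)).
Qed.

Lemma rel_unit_retract : rel_unit_mor ∘ (rel_retract ∘ coinv_mor hS Q) = idm _.
Proof.
apply: (coinv_mor_mono (hC := hS)); rewrite comp_assoc rel_unit_morE comp_idr comp_assoc.
(* Since [1 ⊗_B s(a)n = s(a) ⊗_B n], this composite is the averaging operator of the comodule
   [A ⊗_B N]. *)
have -> : q ∘ tin T N (alg_one A) ∘ rel_retract = tcontract T Q phi ∘ coact Q.
  apply: rel_ext => a; right_nest; rewrite rel_retractE rel_coactE.
  rewrite -rel_balanced alg_mul1l.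
  rewrite -[incl _]/(slicer TV _ phi (ca_coact A a)); move: (ca_coact A a).
  apply: vtensor_mor_eq.
  - apply: comp_linear_r; apply: tin_comp_linear; exact: linearP.
  - by do 2!apply: comp_linear_r; apply: tin_linear.
  move=> c h; rewrite slicerE tmapl_assocE tcontractEr.
  by rewrite tinZ [LHS]scale_compr.
(* On coinvariants averaging is multiplication by [φ(1) = 1]. *)
rewrite -comp_assoc -(proj1 (coinv_morP hS Q)) tcontractEr phi1.
exact: scale1r.
Qed.

Lemma rel_unit_iso : exists r : mor (F Q) (N : module_category TV T B),
  r ∘ rel_unit = idm _ /\ rel_unit ∘ r = idm _.
Proof.
pose r : mor (coinv_obj hS Q) N := rel_retract ∘ coinv_mor hS Q.
(* The inverse of a [B]-linear map is [B]-linear. *)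
have r_hom : @is_module_hom _ _ _ _ _ (coinv_module hS Q) N r.
  rewrite /is_module_hom -[LHS]comp_idr -(tmapl_id T) -rel_unit_retract tmapl_comp.
  rewrite -(comp_assoc r) (comp_assoc (act _)) -rel_unit_hom.
  by rewrite !(comp_assoc r) rel_retract_unit comp_idl.
exists (exist _ r r_hom).
by split; apply: eq_exist; [apply: rel_retract_unit | apply: rel_unit_retract].
Qed.

End Averaging.

Lemma rel_unit_universal_iso : cosemisimple H ->
  universal_iso (F := F) (L := Q : hopf_module_category T A) rel_unit.
Proof.
by move=> [phi [phi_int phi1]]; split; [apply: rel_unit_iso phi1 | apply: rel_universal].
Qed.

End RelativeTensor.

Theorem theorem6p15
  (k : fieldType)
  (* a choice of tensor product of k-vector spaces *)
  (TV : tensoring (modk k))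
  (* a k-linear Grothendieck category, with its tensor products M ⊗ V *)
  (S : lincat k) (hS : is_grothendieck S) (T : tensoring S)
  (H : hopf_algebra TV) (hH : cosemisimple H)
  (A : comodule_algebra H)
  (* HOM is the functor _B HOM(A, -), for B = A^{co H} *)
  (HOM : functor (module_category TV T (coinv_alg A)) (hopf_module_category T A))
  (adj : adjunction (coinv_functor T A hS) HOM)
  (N : module_category TV T (coinv_alg A))
  (* E is the injective envelope of N *)
  (E : module_category TV T (coinv_alg A)) (i : mor N E)
  (hE : is_injective_envelope i)
  (* E' is the injective envelope of HOM N *)
  (E' : hopf_module_category T A) (j : mor (HOM N) E')
  (hE' : is_injective_envelope j) :
  isomorphic E' (HOM E) /\ isomorphic (coinv_functor T A hS E') E.
Proof.
have HF (M : module_category TV T (coinv_alg A)) : exists (L : hopf_module_category T A)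
    (eta : mor M (coinv_functor T A hS L)), universal_iso eta.
  by exists (rel_hopf_module hS M), (rel_unit hS M); apply: rel_unit_universal_iso.
(* Both objects are injective envelopes of [HOM N]. *)
have isoE' : isomorphic E' (HOM E).
  exact: injective_envelope_unique hE' (right_adjoint_injective_envelope adj HF hE).
split=> //; apply: isomorphic_trans (fmap_isomorphic _ isoE') _.
(* Applying coinvariants to the first isomorphism leaves the coinvariants of [HOM E], which the
   counit identifies with [E]. *)
have [r [cr rc]] := counit_iso adj HF E.
by exists (adj_counit adj E), r.
Qed.
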